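(* Let $G$ be a simple graph, $D$ a positive integer with $D\ge\Delta(G)$, and $e=xy$ a $(D,x)$-weak edge. There is an algorithm which, given any partial $D$-edge-coloring $\pi$ of $G$ coloring a set $E_c$ of edges with $e\notin E_c$ (represented by adjacency lists and, for each vertex $v$, an array $M_v$ of size $D$ mapping each color of $\pi(v)$ to the edge at $v$ with that color), finds a partial $D$-edge-coloring $\pi'$ coloring exactly $E_c\cup\{e\}$. The algorithm runs in time $O(D+|P|)$, where $P$ is a maximal alternating path (with respect to $\pi$) with an endpoint in $x$, possibly $P=\emptyset$. Moreover: (V1) if desired, one can specify the color $c'\in\bar\pi(x)$ that alternates in $P$; (V2) $\pi'$ may differ from $\pi$ only on edges incident to $x$ and on edges of $P$; (V3) if $\pi(v)\neq\pi'(v)$ for a vertex $v$, then $v\in N[x]$ or $v$ is the other endpoint of $P$; (V4) the type of $P$ can be determined in time $O(D)$; (V5) the type of $P$ depends only on the set $\{(\pi(xz),\pi(z)) : z\in N(x)\}$.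
   Context: A partial $D$-edge-coloring of $G$ is a function $\pi:E(G)\to\{1,\ldots,D\}\cup\{\bot\}$ ($\bot$ meaning uncolored) such that incident edges both colored from $\{1,\ldots,D\}$ get different colors. For a vertex $v$, $\pi(v)=\{\pi(vw):w\in N(v)\}\setminus\{\bot\}$ and $\bar\pi(v)=\{1,\ldots,D\}\setminus\pi(v)$. $N[x]=N(x)\cup\{x\}$ is the closed neighborhood. $d^D(u)$ is the number of neighbors of $u$ of degree exactly $D$; $[P]$ is $1$ if $P$ holds and $0$ otherwise. An edge $uv$ is $(D,u)$-weak if $d^D(u)\le D-d(v)+[d(v)=D]$. An $(a,b)$-alternating path is a path whose edges are colored alternately $a$ and $b$; it is maximal if it cannot be extended to a longer $(a,b)$-alternating path; the unordered pair $\{a,b\}$ is its type (the type of an empty path $P=\emptyset$ is $\emptyset$).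
   Formalization: Entries of M_v at colors not in π(v), plus one header cell, store the sorted list of missing colors (kept in the output; with null entries O(D) fails). In (V5) the type may also depend on π(y) and the requested color c'; the set alone does not identify y if x has several uncolored edges. *)

(* Defs.v *)
From mathcomp Require Import all_boot.

Set Implicit Arguments.
Unset Strict Implicit.
Unset Printing Implicit Defensive.

(** * Graphs and partial edge-colorings

    A simple graph is a symmetric irreflexive [adj : rel T]
    on a finite type of vertices; the edge between [u] and [v] is the set
    [[set u; v]]. *)

Section Graph.
Variables (T : finType) (adj : rel T).

Definition edges : {set {set T}} :=
  [set e | [exists u, exists v, adj u v && (e == [set u; v])]].

Definition nbr (v : T) : {set T} := [set w | adj v w].
Definition cnbr (v : T) : {set T} := v |: nbr v.
Definition deg (v : T) : nat := #|nbr v|.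
Definition max_deg : nat := \max_(v : T) deg v.

(* [D - deg v] is a true difference whenever [max_deg <= D]. *)
Definition weak (D : nat) (u v : T) : Prop :=
  adj u v /\ #|[set w in nbr u | deg w == D]| <= D - deg v + (deg v == D).

End Graph.

(** The color [c : 'I_D] stands for the color [c.+1] of [{1, ..., D}];
    [None] stands for "uncolored". *)
Definition coloring (T : finType) (D : nat) := {ffun {set T} -> option 'I_D}.

Section Coloring.
Variables (T : finType) (adj : rel T) (D : nat) (pi : coloring T D).

Definition colored : {set {set T}} := [set e | pi e != None].

Definition partial_coloring : Prop :=
  colored \subset edges adj /\
  (forall e f : {set T}, e != f -> e :&: f != set0 ->
     forall c d : 'I_D, pi e = Some c -> pi f = Some d -> c != d).

Definition palette (v : T) : {set 'I_D} :=
  [set c | [exists w in nbr adj v, pi [set v; w] == Some c]].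

Definition missing (v : T) : {set 'I_D} := ~: palette v.

Definition nbr_view (x : T) : {set option 'I_D * {set 'I_D}} :=
  [set (pi [set x; z], palette z) | z in nbr adj x].

(** A path is given by its first vertex [x] and the sequence [s] of its
    remaining vertices, so it has [size s] edges. *)
Definition path_edges (x : T) (s : seq T) : seq {set T} :=
  pairmap (fun u w => [set u; w]) x s.

Definition alternate (a b : 'I_D) (n : nat) : seq (option 'I_D) :=
  mkseq (fun i => Some (if odd i then b else a)) n.

Definition alt_path (a b : 'I_D) (x : T) (s : seq T) : Prop :=
  [/\ path adj x s, uniq (x :: s)
    & [seq pi e | e <- path_edges x s] = alternate a b (size s) \/
      [seq pi e | e <- path_edges x s] = alternate b a (size s)].

Definition max_alt_path (a b : 'I_D) (x : T) (s : seq T) : Prop :=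
  alt_path a b x s /\
  (forall (u : T) (r : seq T), alt_path a b u r -> infix (x :: s) (u :: r) ->
     size r <= size s).

(** [s = [::]] encodes the empty path, whose type is [set0]. *)
Definition max_alt_path_or_empty (x : T) (s : seq T) (t : {set 'I_D}) : Prop :=
  (s = [::] /\ t = set0) \/
  (s <> [::] /\ exists a b : 'I_D,
     [/\ a != b, t = [set a; b] & max_alt_path a b x s]).

End Coloring.

(** * Random access machine

    Programs have finitely many registers and one unbounded memory of natural
    numbers.  The only arithmetic is addition and truncated subtraction, and
    every node of an expression, test or command costs one unit of time each
    time it is evaluated (uniform cost). *)

Inductive exp : Type :=
| Cst of nat
| Reg of nat
| Add of exp & exp
| Sub of exp & exp
| Read of exp.

Inductive test : Type :=
| Leq of exp & exp
| Eqn of exp & exp.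

Inductive cmd : Type :=
| Skip
| Assign of nat & exp
| Write of exp & exp
| Seq of cmd & cmd
| If of test & cmd & cmd
| While of test & cmd.

Record state : Type := State { regs : nat -> nat; heap : nat -> nat }.

Definition upd (f : nat -> nat) (i v : nat) : nat -> nat :=
  fun j => if j == i then v else f j.

Fixpoint eval (s : state) (e : exp) : nat :=
  match e with
  | Cst n => n
  | Reg r => regs s r
  | Add e1 e2 => eval s e1 + eval s e2
  | Sub e1 e2 => eval s e1 - eval s e2
  | Read e1 => heap s (eval s e1)
  end.

Fixpoint exp_cost (e : exp) : nat :=
  match e with
  | Cst _ | Reg _ => 1
  | Add e1 e2 | Sub e1 e2 => (exp_cost e1 + exp_cost e2).+1
  | Read e1 => (exp_cost e1).+1
  end.

Definition eval_test (s : state) (b : test) : bool :=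
  match b with
  | Leq e1 e2 => eval s e1 <= eval s e2
  | Eqn e1 e2 => eval s e1 == eval s e2
  end.

Definition test_cost (b : test) : nat :=
  match b with
  | Leq e1 e2 | Eqn e1 e2 => (exp_cost e1 + exp_cost e2).+1
  end.

(** [exec p s k s']: started in [s], the program [p] halts in [s'] after
    exactly [k] units of time. *)
Inductive exec : cmd -> state -> nat -> state -> Prop :=
| ExSkip s : exec Skip s 1 s
| ExAssign r e s :
    exec (Assign r e) s (exp_cost e).+1
         (State (upd (regs s) r (eval s e)) (heap s))
| ExWrite a e s :
    exec (Write a e) s (exp_cost a + exp_cost e).+1
         (State (regs s) (upd (heap s) (eval s a) (eval s e)))
| ExSeq p q s1 k1 s2 k2 s3 :
    exec p s1 k1 s2 -> exec q s2 k2 s3 -> exec (Seq p q) s1 (k1 + k2).+1 s3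
| ExIf b p q s k s' :
    exec (if eval_test s b then p else q) s k s' ->
    exec (If b p q) s (test_cost b + k).+1 s'
| ExWhileEnd b p s :
    ~~ eval_test s b -> exec (While b p) s (test_cost b).+1 s
| ExWhileLoop b p s1 k1 s2 k2 s3 :
    eval_test s1 b -> exec p s1 k1 s2 -> exec (While b p) s2 k2 s3 ->
    exec (While b p) s1 (test_cost b + k1 + k2).+1 s3.

(** * Representation of a partially colored graph in memory

    A vertex is denoted by the address of its record, which holds a pointer to
    its adjacency list (a linked list) and the address of its array [M_v].
    As the graph is simple, an edge at [v] is denoted, in the adjacency list
    and in [M_v], by its other endpoint.

    [M_v] consists of a header (offset 0) and one entry for each color
    [1, ..., D].  The entry of a color of [palette v] is the edge at [v] with
    that color.  The header and the entries of the missing colors, where there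
    is no edge to store, form the increasing linked list of the missing colors:
    the header is the least missing color and the entry of a missing color is
    the next larger one, with [0] for none.  Vertex addresses being larger than
    [D], the two kinds of entries are told apart in constant time.  With null
    entries instead, finding one missing color of one vertex would already need
    time of order [D] in the worst case. *)

Definition color_code (D : nat) (c : 'I_D) : nat := c.+1.

Definition ocolor_code (D : nat) (oc : option 'I_D) : nat :=
  if oc is Some c then color_code c else 0.

(* The least code larger than [k] of a color of [A], or [0]; recall that
   [enum A] is increasing. *)
Definition next_code (D : nat) (A : {set 'I_D}) (k : nat) : nat :=
  head 0 [seq color_code c | c <- enum A & k < color_code c].

Record layout (T : finType) : Type := Layout {
  vaddr : T -> nat;                (* address of the record of a vertex *)
  marr : T -> nat;                 (* address of [M_v] *)
  alist : T -> seq (nat * T)       (* list cells: address and neighbor *)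
}.

Section Representation.
Variables (T : finType) (adj : rel T) (D : nat) (L : layout T).

Definition cells (v : T) : seq nat :=
  [:: vaddr L v; (vaddr L v).+1]
  ++ flatten [seq [:: q.1; q.1.+1] | q <- alist L v]
  ++ iota (marr L v) D.+1.

(* Distinct objects do not overlap and lie in the addresses between [D] and
   [free], so everything from [free] on is available as working space. *)
Definition wf_layout (free : nat) : Prop :=
  [/\ uniq (flatten [seq cells v | v <- enum T]),
      (forall v, all (fun a => D < a < free) (cells v))
    & forall v, perm_eq [seq q.2 | q <- alist L v] (enum (nbr adj v))].

Fixpoint list_at (h : nat -> nat) (p : nat) (l : seq (nat * T)) : Prop :=
  match l with
  | [::] => p = 0
  | q :: l' => [/\ p = q.1, h q.1 = vaddr L q.2 & list_at h (h q.1.+1) l']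
  end.

Definition represents (pi : coloring T D) (h : nat -> nat) : Prop :=
  forall v : T,
  [/\ list_at h (h (vaddr L v)) (alist L v),
      h (vaddr L v).+1 = marr L v,
      (forall (w : T) (c : 'I_D), adj v w -> pi [set v; w] = Some c ->
         h (marr L v + color_code c) = vaddr L w),
      h (marr L v) = next_code (missing adj pi v) 0
    & forall c : 'I_D, c \in missing adj pi v ->
        h (marr L v + color_code c)
          = next_code (missing adj pi v) (color_code c)].

(** The arguments are passed in registers 0 to 4; the other registers and the
    working space have arbitrary initial contents.  [oc] is the color requested
    to alternate in the path, if any. *)
Definition input (pi : coloring T D) (x y : T) (oc : option 'I_D) (s : state)
  : Prop :=
  [/\ [/\ regs s 0 = D, regs s 1 = vaddr L x, regs s 2 = vaddr L y
        & regs s 3 = ocolor_code oc],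
      wf_layout (regs s 4)
    & represents pi (heap s)].

End Representation.

(** Registers 0 and 1 hold the type [t] of a path, both being 0 for [set0]. *)
Definition outputs_type (D : nat) (t : {set 'I_D}) (s : state) : Prop :=
  (t = set0 /\ regs s 0 = 0 /\ regs s 1 = 0) \/
  (exists a b : 'I_D, [/\ a != b, t = [set a; b],
     regs s 0 = color_code a & regs s 1 = color_code b]).

(* Main.v *)
(** The fan of Vizing's theorem is explored from [y] in full: starting with [y],
    each missing color of a fan vertex that is not missing at [x] leads to the
    next fan vertex, the neighbor of [x] along the edge of that color.  If no
    color were missing at two fan vertices, or at a fan vertex and at [x], then
    the fan vertices other than [y] would correspond to the colors missing at
    fan vertices; as only the neighbors of [x] of degree [D] may miss no color,
    this contradicts the weakness of the edge.  If a color is missing at a fan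
    vertex and at [x], the edges from [x] to the ancestors of this vertex are
    recolored, and no path is needed.  If [b] is missing at two fan vertices,
    [a] and [b] are first exchanged along the maximal alternating path from [x],
    where [a] is missing at [x]; at least one of the two vertices, chosen by the
    other end of the path, can then be used in the same way.

    Recoloring changes the sorted list of missing colors of every vertex of the
    chain, but until the first conflict these lists are pairwise disjoint, so
    that all the linear searches in them together take time [O(D)]. *)

Require Import Defs.
From mathcomp Require Import all_boot zify.

Set Implicit Arguments.
Unset Strict Implicit.
Unset Printing Implicit Defensive.

(** * Total correctness of programs with a time bound *)

(** A partial coloring is handled as a system [R v c], the neighbor of [v] along color [c], which is
    what the arrays store. Fan vertices are named by colors at [x], so that the search is a function
    of the palettes around [x] alone; this gives (V5), and all tables of the search have size of
    order [D]. The delicate case is a color [b] missing at two fan vertices, the earlier [k'] and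
    the current one. The exchange turns the edge of color [b] at [x], whose end was found from [k'],
    into an edge of color [a]. The chain of the current vertex may use this edge; then [k'] has to
    miss [a], which holds if the path ends at [k'], and in that case the current vertex still misses
    [b]. Otherwise [k'] still misses [b], and its own chain consists of colors recorded before [b].
    The sorted lists would spoil the time bound if every vertex of the path needed a search. Only
    the two ends do: at an inner vertex both colors are present before and after the exchange. *)

Definition runs (p : cmd) (s : state) (K : nat) (Q : state -> Prop) : Prop :=
  exists k s', [/\ exec p s k s', k <= K & Q s'].

Lemma exec_gt0 p s k s' : exec p s k s' -> 0 < k.
Proof. by case. Qed.

Lemma runs_weaken p s K1 K2 (Q1 Q2 : state -> Prop) :
  runs p s K1 Q1 -> K1 <= K2 -> (forall s', Q1 s' -> Q2 s') -> runs p s K2 Q2.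
Proof.
move=> [k [s' [e le q]]] le12 q12; exists k, s'; split=> //; last exact: q12.
exact: leq_trans le12.
Qed.

(* No side condition on [K] is needed below: programs cost at least 1, so
   nothing runs within a truncated budget of 0. *)
Lemma runs_skip s K (Q : state -> Prop) : 0 < K -> Q s -> runs Skip s K Q.
Proof. by move=> hK q; exists 1, s; split=> //; constructor. Qed.

Lemma runs_assign r e s K (Q : state -> Prop) : exp_cost e < K ->
  Q (State (upd (regs s) r (eval s e)) (heap s)) -> runs (Assign r e) s K Q.
Proof. by move=> hK q; eexists _, _; split; first by constructor. Qed.

Lemma runs_write a e s K (Q : state -> Prop) : exp_cost a + exp_cost e < K ->
  Q (State (regs s) (upd (heap s) (eval s a) (eval s e))) ->
  runs (Write a e) s K Q.
Proof. by move=> hK q; eexists _, _; split; first by constructor. Qed.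

Lemma runs_if b p q s K Q :
  runs (if eval_test s b then p else q) s (K - (test_cost b).+1) Q ->
  runs (If b p q) s K Q.
Proof.
move=> [k [s' [e le Qs]]]; exists (test_cost b + k).+1, s'; split=> //.
  by constructor.
by have := exec_gt0 e; lia.
Qed.

Lemma runs_seq p q s K1 K2 K (Q1 Q : state -> Prop) :
  runs p s K1 Q1 -> (forall s', Q1 s' -> runs q s' K2 Q) -> K1 + K2 < K ->
  runs (Seq p q) s K Q.
Proof.
move=> [k1 [s1 [e1 le1 Q1s]]] /(_ _ Q1s) [k2 [s2 [e2 le2 Qs]]] hK.
exists (k1 + k2).+1, s2; split=> //; last by lia.
exact: ExSeq e1 e2.
Qed.

Lemma runs_seq_skip q s K Q : runs q s (K - 2) Q -> runs (Seq Skip q) s K Q.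
Proof.
move=> [k [s' [e le Qs]]]; exists (1 + k).+1, s'; split=> //.
  by apply: ExSeq e; constructor.
by have := exec_gt0 e; lia.
Qed.

Lemma runs_seq_assign r e q s K Q :
  runs q (State (upd (regs s) r (eval s e)) (heap s)) (K - (exp_cost e).+2) Q ->
  runs (Seq (Assign r e) q) s K Q.
Proof.
move=> [k [s' [ex le Qs]]]; exists ((exp_cost e).+1 + k).+1, s'; split=> //.
  by apply: ExSeq ex; constructor.
by have := exec_gt0 ex; lia.
Qed.

Lemma runs_seq_write a e q s K Q :
  runs q (State (regs s) (upd (heap s) (eval s a) (eval s e)))
    (K - (exp_cost a + exp_cost e).+2) Q ->
  runs (Seq (Write a e) q) s K Q.
Proof.
move=> [k [s' [ex le Qs]]].
exists ((exp_cost a + exp_cost e).+1 + k).+1, s'; split=> //.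
  by apply: ExSeq ex; constructor.
by have := exec_gt0 ex; lia.
Qed.

(** Both nestings have two sequence nodes and hence the same cost; [step] uses this to bring the
    next elementary command to the front. *)
Lemma runs_seqA p q r s K Q :
  runs (Seq p (Seq q r)) s K Q -> runs (Seq (Seq p q) r) s K Q.
Proof.
move=> [k [s' [ex le Qs]]]; exists k, s'; split=> //.
inversion_clear ex as [| | | ? ? ? k1 s1 k2 ? e1 e2 | | | ].
inversion_clear e2 as [| | | ? ? ? k3 s3 k4 ? e3 e4 | | | ].
have -> : (k1 + (k3 + k4).+1).+1 = ((k1 + k3).+1 + k4).+1 by lia.
by apply: ExSeq e4; apply: ExSeq e3.
Qed.

(** Moving the continuation into the chosen branch is free: the sequence node is evaluated once in
    either form. *)
Lemma runs_seq_if b p q r s K Q :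
  runs (Seq (if eval_test s b then p else q) r) s (K - (test_cost b).+1) Q ->
  runs (Seq (If b p q) r) s K Q.
Proof.
move=> [k [s' [ex le Qs]]].
exists (test_cost b + k).+1, s'; split=> //; last first.
  by have := exec_gt0 ex; lia.
inversion_clear ex as [| | | ? ? ? k1 s1 k2 ? e1 e2 | | | ].
have -> : (test_cost b + (k1 + k2).+1).+1 = ((test_cost b + k1).+1 + k2).+1.
  by lia.
by apply: ExSeq e2; constructor.
Qed.

(** A single unfolding, for the loops that are proved by induction on a path or a chain. *)
Lemma runs_while b p s K1 K (Q1 Q : state -> Prop) :
  test_cost b < K ->
  (~~ eval_test s b -> Q s) ->
  (eval_test s b -> runs p s K1 Q1) ->
  (eval_test s b -> forall s', Q1 s' ->
     runs (While b p) s' (K - (test_cost b).+1 - K1) Q) ->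
  runs (While b p) s K Q.
Proof.
move=> hK hQ hp hw; case hb: (eval_test s b); last first.
  exists (test_cost b).+1, s; split=> //; last by apply: hQ; rewrite hb.
  by apply: ExWhileEnd; rewrite hb.
have [k1 [s1 [e1 le1 Q1s]]] := hp hb; have [k2 [s2 [e2 le2 Qs]]] := hw hb _ Q1s.
exists (test_cost b + k1 + k2).+1, s2; split=> //.
  exact: ExWhileLoop hb e1 e2.
by have := exec_gt0 e2; lia.
Qed.

(* [I n s]: at most [n] further iterations. *)
Lemma runs_while_iter b p B (I : nat -> state -> Prop) (Q : state -> Prop) :
  (forall n s, I n s -> ~~ eval_test s b -> Q s) ->
  (forall n s, I n s -> eval_test s b ->
     0 < n /\ runs p s B (I n.-1)) ->
  forall n s, I n s ->
    runs (While b p) s (n * (B + (test_cost b).+1) + (test_cost b).+1) Q.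
Proof.
move=> hQ hB; elim=> [|n IHn] s Is.
  apply: (@runs_while _ _ _ 0 _ (fun=> True)) => //.
  - exact: hQ Is.
  - by move=> hb; have [] := hB _ _ Is hb.
  - by move=> hb; have [] := hB _ _ Is hb.
apply: (@runs_while _ _ _ B _ (I n)); first by lia.
- exact: hQ Is.
- by move=> hb; have [] := hB _ _ Is hb.
by move=> _ s' /IHn r; apply: runs_weaken r _ _ => //; lia.
Qed.

Lemma updE f i v j : upd f i v j = if j == i then v else f j.
Proof. by []. Qed.

Lemma upd_eq f i v : upd f i v i = v.
Proof. by rewrite updE eqxx. Qed.

Lemma upd_neq f i v j : j != i -> upd f i v j = f j.
Proof. by rewrite updE => /negbTE->. Qed.

Lemma upd_lt j f i v : j < i -> upd f i v j = f j.
Proof. by move=> lt; rewrite upd_neq //; lia. Qed.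

Lemma upd_ge N j f i v : j < N -> N <= i -> upd f i v j = f j.
Proof. by move=> lt le; apply: upd_lt; apply: leq_trans lt le. Qed.

Ltac is_numeral n :=
  lazymatch n with 0 => idtac | S ?m => is_numeral m | _ => fail end.

(* Reads registers; heap addresses are symbolic and hence left alone. *)
Ltac rsimp :=
  cbn [eval regs heap eval_test];
  repeat match goal with
  | |- context [upd ?f ?i ?v ?j] =>
      is_numeral i; is_numeral j;
      let b := eval compute in (j == i) in
      match b with
      | true => change (upd f i v j) with v
      | false => change (upd f i v j) with (f j)
      end
  end.

Ltac frame_tac :=
  try (let i := fresh "i" in let lt := fresh "lt" in move=> i lt);
  rsimp; rewrite ?upd_lt //; try lia.

Ltac step :=
  first [ apply: runs_seqA | apply: runs_seq_skip | apply: runs_seq_assign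
        | apply: runs_seq_write | apply: runs_seq_if ]; rsimp.

Ltac budget := clear; rewrite -?subnDA /=; lia.

(** * Sorted lists of missing colors *)

Lemma sorted_enum_code D (A : {set 'I_D}) :
  sorted ltn [seq color_code c | c <- enum A].
Proof.
suff : sorted (relpre (@color_code D) ltn) (enum A) by rewrite -sorted_map.
rewrite /enum_mem; apply: sorted_filter.
  by move=> a b c /=; apply: ltn_trans.
rewrite -enumT -sorted_map.
have -> : [seq color_code c | c <- enum 'I_D] = iota 1 D.
  by rewrite (map_comp S val) val_enum_ord -[1]addn0 iotaDl.
exact: iota_ltn_sorted.
Qed.

Definition later D (A : {set 'I_D}) (k : nat) : seq 'I_D :=
  [seq c <- enum A | k < color_code c].

Definition ohead_code D (s : seq 'I_D) : nat := head 0 [seq color_code c | c <- s].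

Lemma next_codeE D (A : {set 'I_D}) k : next_code A k = ohead_code (later A k).
Proof. by []. Qed.

Lemma mem_later D (A : {set 'I_D}) k c :
  (c \in later A k) = (k < c.+1) && (c \in A).
Proof. by rewrite mem_filter mem_enum. Qed.

Lemma sorted_later D (A : {set 'I_D}) k :
  sorted (relpre (@color_code D) ltn) (later A k).
Proof.
apply: sorted_filter; first by move=> a b c /=; apply: ltn_trans.
by rewrite -sorted_map sorted_enum_code.
Qed.

Lemma later_cons D (A : {set 'I_D}) k c t :
  later A k = c :: t -> c \in A /\ t = later A c.+1.
Proof.
move=> e; have : c \in later A k by rewrite e mem_head.
rewrite mem_later => /andP[kc cA]; split=> //.
have := sorted_later A k; rewrite e /= path_sortedE; last first.
  by move=> x y z /=; apply: ltn_trans.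
case/andP => /allP ct _.
have -> : later A c.+1 = [seq x : 'I_D <- later A k | c.+1 < x.+1].
  rewrite /later -filter_predI; apply: eq_filter => x /=.
  by rewrite /color_code; lia.
rewrite e /= ltnn; apply/esym/all_filterP/allP => x xt.
exact: ct.
Qed.

Lemma later0 D (A : {set 'I_D}) : later A 0 = enum A.
Proof. exact/all_filterP/allP. Qed.

(** This order-theoretic description determines [next_code], so updates of the lists are verified by
    comparing colors instead of rewriting sorted sequences. *)
Definition is_next D (A : {set 'I_D}) (k n : nat) : Prop :=
  (n = 0 /\ forall c : 'I_D, c \in A -> c.+1 <= k) \/
  (exists c : 'I_D, [/\ n = c.+1, c \in A, k < c.+1
     & forall d : 'I_D, d \in A -> k < d.+1 -> c <= d]).

Lemma next_codeP D (A : {set 'I_D}) k : is_next A k (next_code A k).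
Proof.
rewrite next_codeE; case e : (later A k) => [|c t].
  left; split=> // c cA; rewrite leqNgt; apply/negP => kc.
  by have := mem_later A k c; rewrite e kc cA.
right; exists c; have : c \in later A k by rewrite e mem_head.
rewrite mem_later => /andP[kc cA]; split=> // d dA kd.
have : d \in later A k by rewrite mem_later kd.
rewrite e inE => /orP[/eqP-> //|].
by have [_ ->] := later_cons e; rewrite mem_later => /andP[]; lia.
Qed.

Lemma is_next_uniq D (A : {set 'I_D}) k n : is_next A k n -> next_code A k = n.
Proof.
case: (next_codeP A k) => [[-> h]|[c [-> cA kc hc]]].
  by case=> [[] //|[d [-> dA kd _]]]; have := h _ dA; lia.
case=> [[-> h]|[d [-> dA kd hd]]]; first by have := h _ cA; lia.
by have := hc _ dA kd; have := hd _ cA kc; lia.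
Qed.

(* The position of [c] in the list of [A]: [p] is the offset of the entry
   (the header, or the entry of a color of [A]) that precedes [c]. *)
Definition is_prev D (A : {set 'I_D}) (c p : nat) : Prop :=
  [/\ p < c, p = 0 \/ exists2 d : 'I_D, d \in A & p = d.+1
    & forall d : 'I_D, d \in A -> d.+1 < c -> d.+1 <= p].

Lemma next_code_le D (A : {set 'I_D}) k : next_code A k <= D.
Proof. by case: (next_codeP A k) => [[-> //]|[c [->]]]; have := ltn_ord c. Qed.

(** * Rows: the arrays [M_v] *)

Definition blank (T : finType) D (r : 'I_D -> option T) : {set 'I_D} :=
  [set c | r c == None].

Definition upr (A : eqType) (B : Type) (r : A -> B) (a : A) (b : B) : A -> B :=
  fun d => if d == a then b else r d.

Section Row.
Variables (T : finType) (D : nat) (addr : T -> nat).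
Implicit Types (h : nat -> nat) (r : 'I_D -> option T).

Definition row_ok h (m : nat) r : Prop :=
  [/\ forall c w, r c = Some w -> h (m + c.+1) = addr w,
      h m = next_code (blank r) 0
    & forall c, r c = None -> h (m + c.+1) = next_code (blank r) c.+1].

Lemma code_eq (c d : 'I_D) : (c.+1 == d.+1) = (c == d).
Proof. by []. Qed.

Lemma in_blank r c : (c \in blank r) = (r c == None).
Proof. by rewrite inE. Qed.

Lemma row_ok_eq h h' m r : (forall i, i <= D -> h' (m + i) = h (m + i)) ->
  row_ok h m r -> row_ok h' m r.
Proof.
move=> e [h1 h2 h3]; split=> [c w rc||c rc].
- by rewrite e //; apply: h1.
- by have := e 0 (leq0n D); rewrite addn0 => ->.
- by rewrite e //; apply: h3.
Qed.

Lemma eq_blank r r' : r =1 r' -> blank r = blank r'.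
Proof. by move=> e; apply/setP => c; rewrite !inE e. Qed.

Lemma row_ok_ext h m r r' : r =1 r' -> row_ok h m r -> row_ok h m r'.
Proof.
move=> e [h1 h2 h3]; rewrite /row_ok -(eq_blank e).
by split=> // c => [w|]; rewrite -e; [exact: h1|exact: h3].
Qed.

Lemma blank_upr_Some r c w : blank (upr r c (Some w)) = blank r :\ c.
Proof. by apply/setP => d; rewrite !inE /upr; case: (d == c). Qed.

Lemma blank_upr_None r c : blank (upr r c None) = c |: blank r.
Proof. by apply/setP => d; rewrite !inE /upr; case: (d == c). Qed.

Lemma row_ok_next h m r k : row_ok h m r ->
  k = 0 \/ (exists2 d : 'I_D, d \in blank r & k = d.+1) ->
  h (m + k) = next_code (blank r) k.
Proof.
case=> _ h2 h3 [->|[d dA ->]]; first by rewrite addn0.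
by apply: h3; apply/eqP; rewrite -in_blank.
Qed.

(** The color stays present, so the list of missing colors is the same and one write suffices: this
    is the constant-time update of an inner vertex of the path. *)
Lemma row_set h m r c w w' : row_ok h m r -> r c = Some w ->
  row_ok (upd h (m + c.+1) (addr w')) m (upr r c (Some w')).
Proof.
move=> [h1 h2 h3] rc.
have e : blank (upr r c (Some w')) = blank r.
  by apply/setP => d; rewrite !inE /upr; have [->|//] := eqVneq d c; rewrite rc.
split=> [d v||d]; rewrite /upr ?e.
- rewrite updE eqn_add2l code_eq.
  by have [_ [->]|_ /h1] := eqVneq d c.
- by rewrite upd_neq ?h2 //; lia.
rewrite updE eqn_add2l code_eq.
by have [//|_ /h3] := eqVneq d c.
Qed.

Lemma row_del h m r c p w : row_ok h m r -> r c = None ->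
  is_prev (blank r) c.+1 p ->
  row_ok (upd (upd h (m + p) (h (m + c.+1))) (m + c.+1) (addr w)) m
    (upr r c (Some w)).
Proof.
move=> hr rc [pc hp np]; have [h1 h2 h3] := hr.
have cA : c \in blank r by rewrite in_blank rc.
have hnp := row_ok_next hr hp; have hnc := h3 _ rc.
set A' := blank (upr r c (Some w)); have A'E : A' = blank r :\ c.
  exact: blank_upr_Some.
have memA' d : (d \in A') = (d != c) && (d \in blank r).
  by rewrite A'E in_setD1.
(* All remaining links, header included, are checked at once; only the one at [p] changes,
   inheriting the successor of [c]. *)
have keep k : k = 0 \/ (exists2 d : 'I_D, d \in A' & k = d.+1) ->
    upd (upd h (m + p) (h (m + c.+1))) (m + c.+1) (addr w) (m + k)
    = next_code A' k.
  move=> hk; have kc : k != c.+1.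
    case: hk => [-> //|[d]]; rewrite memA' => /andP[dc _] ->.
    by apply: contra dc => /eqP[e]; apply/eqP/val_inj.
  rewrite upd_neq ?eqn_add2l // updE eqn_add2l; apply/esym/is_next_uniq.
  have hk' : k = 0 \/ (exists2 d : 'I_D, d \in blank r & k = d.+1).
    case: hk => [|[d]]; [by left|rewrite memA' => /andP[_ dA] ->].
    by right; exists d.
  case: eqP => [->{k kc hk hk'}|/eqP kp].
    rewrite hnc; case: (next_codeP (blank r) c.+1) => [[-> no]|].
      left; split=> // d; rewrite memA' => /andP[/eqP dc dA].
      have := no _ dA; rewrite ltnS => le; apply: np => //.
      by rewrite ltnS ltn_neqAle le andbT; apply/negP => /eqP/val_inj.
    case=> [d [-> dA cd hd]]; right; exists d; split=> //.
    - by rewrite memA' dA andbT; apply/eqP => e; move: cd; rewrite e ltnn.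
    - by lia.
    - move=> d'; rewrite memA' => /andP[/eqP dc dA'] pd.
      apply: hd => //; rewrite ltnNge; apply/negP => le.
      have := np _ dA'; have : (d' : nat) <> c by move/val_inj.
      by lia.
  rewrite (row_ok_next hr hk').
  case: (next_codeP (blank r) k) => [[-> no]|].
    by left; split=> // d; rewrite memA' => /andP[_ /no].
  case=> [d [-> dA kd hd]]; right; exists d; split=> //.
    (* If [c] were the successor of [k], then [k] would be the predecessor [p]. *)
    rewrite memA' dA andbT; apply/eqP => e; subst d.
    case: (ltngtP p k) kp => // pk _.
    - case: hk' => [k0|[d dA' e]]; first by lia.
      by have := np _ dA'; have := val_inj; lia.
    - case: hp => [p0|[d dA' e]]; first by lia.
      by have := hd _ dA'; lia.
  by move=> d'; rewrite memA' => /andP[_ dA']; apply: hd.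
split.
- move=> d v; rewrite /upr updE eqn_add2l code_eq.
  have [_ [->] //|dc rd] := eqVneq d c; rewrite upd_neq ?(h1 _ _ rd) //.
  (* The write at [p] destroys no edge: [p] is the header or the entry of a missing color. *)
  rewrite eqn_add2l; apply/eqP => e; case: hp => [p0|[d' dA' e']].
    by lia.
  have : d = d' by apply: ord_inj; lia.
  by move=> e2; move: dA'; rewrite -e2 in_blank rd.
- by have := keep 0 (or_introl erefl); rewrite addn0.
- move=> d rd; apply: keep; right; exists d => //.
  by rewrite in_blank rd.
Qed.

Lemma row_ins h m r c p : row_ok h m r -> r c <> None ->
  is_prev (blank r) c.+1 p ->
  row_ok (upd (upd h (m + c.+1) (h (m + p))) (m + p) c.+1) m (upr r c None).
Proof.
move=> hr rc [pc hp np]; have [h1 h2 h3] := hr.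
have cA : c \notin blank r by rewrite in_blank; apply/eqP.
have hnp := row_ok_next hr hp.
set A' := blank (upr r c None); have A'E : A' = c |: blank r.
  exact: blank_upr_None.
have memA' d : (d \in A') = (d == c) || (d \in blank r).
  by rewrite A'E in_setU1.
have keep k : k = 0 \/ (exists2 d : 'I_D, d \in A' & k = d.+1) ->
    upd (upd h (m + c.+1) (h (m + p))) (m + p) c.+1 (m + k)
    = next_code A' k.
  move=> hk; rewrite !updE !eqn_add2l; apply/esym/is_next_uniq.
  case: eqP => [->|/eqP kp].
    right; exists c; rewrite memA' eqxx; split=> // d.
    rewrite memA' => /orP[/eqP-> //|dA pd].
    by have := np _ dA; lia.
  case: eqP => [->{k kp hk}|/eqP kc].
    rewrite hnp; case: (next_codeP (blank r) p) => [[-> no]|].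
      left; split=> // d; rewrite memA' => /orP[/eqP-> //|/no].
      by lia.
    case=> [d [-> dA pd hd]]; have dc : d != c.
      by apply: contraNneq cA => <-.
    right; exists d; split=> //.
    - by rewrite memA' dA orbT.
    - rewrite ltnNge; apply/negP => le; have := np _ dA.
      have : (d : nat) <> c by move/val_inj/eqP; rewrite (negbTE dc).
      by lia.
    - move=> d'; rewrite memA' => /orP[/eqP->|dA' cd]; first by rewrite ltnn.
      by apply: hd => //; lia.
  have hk' : k = 0 \/ (exists2 d : 'I_D, d \in blank r & k = d.+1).
    case: hk => [|[d]]; [by left|rewrite memA' => /orP[/eqP->|dA ->]].
      by move=> e; rewrite e eqxx in kc.
    by right; exists d.
  rewrite (row_ok_next hr hk').
  (* A link before [c] and other than [p] lies before [p], so its successor is not affected by the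
     insertion. *)
  have ck : k < c.+1 -> k < p.
    move=> lt; rewrite ltn_neqAle kp /=; case: hk' => [->//|[d dA e]].
    by rewrite e; apply: np => //; rewrite -e.
  case: (next_codeP (blank r) k) => [[-> no]|].
    left; split=> // d; rewrite memA' => /orP[/eqP->|/no //].
    rewrite leqNgt; apply/negP => /ck kltp.
    by case: hp => [p0|[d' /no dA' e]]; lia.
  case=> [d [-> dA kd hd]]; right; exists d; split=> //.
    by rewrite memA' dA orbT.
  move=> d'; rewrite memA' => /orP[/eqP-> lt|]; last exact: hd.
  have kltp := ck lt; case: hp => [p0|[d2 dA2 e]]; first by lia.
  by have := hd _ dA2; lia.
split.
- move=> d v; rewrite /upr; have [//|dc rd] := eqVneq d c.
  rewrite upd_neq ?upd_neq ?eqn_add2l ?(h1 _ _ rd) //.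
  apply/eqP => e; case: hp => [p0|[d' dA' e']]; first by lia.
  have : d = d' by apply: ord_inj; lia.
  by move=> e2; move: dA'; rewrite -e2 in_blank rd.
- by have := keep 0 (or_introl erefl); rewrite addn0.
- move=> d rd; apply: keep; right; exists d => //.
  by rewrite in_blank rd.
Qed.

End Row.

(** * Memory layout *)

Lemma uniq_flatten_map (A : eqType) (B : eqType) (f : A -> seq B) (s : seq A) :
  uniq (flatten (map f s)) ->
  (forall a, a \in s -> uniq (f a)) /\
  (forall a a' b, a \in s -> a' \in s -> b \in f a -> b \in f a' -> a = a').
Proof.
elim: s => [|a s IHs] //=; rewrite cat_uniq => /and3P[ua na us].
have {IHs}[u1 u2] := IHs us; have dis a' b : a' \in s -> b \in f a -> b \notin f a'.
  move=> a's ba; apply: contra na => ba'; apply/hasP; exists b => //.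
  by apply/flattenP; exists (f a') => //; apply: map_f.
split=> [a'|a1 a2 b]; rewrite !inE; first by case/orP => [/eqP->|/u1].
case/orP => [/eqP->|a1s] /orP[/eqP->|a2s] //.
- by move=> b1 b2; have := dis _ _ a2s b1; rewrite b2.
- by move=> b1 b2; have := dis _ _ a1s b2; rewrite b1.
- exact: u2.
Qed.

(** Registers below [N] belong to the callers; each subprogram works in a range of higher
    registers. *)
Definition frame N (s s' : state) : Prop := forall r, r < N -> regs s' r = regs s r.

Lemma frame_trans N s1 s2 s3 : frame N s1 s2 -> frame N s2 s3 -> frame N s1 s3.
Proof. by move=> f1 f2 r lt; rewrite f2 // f1. Qed.

Section Layout.
Variables (T : finType) (adj : rel T) (D : nat) (L : layout T) (free : nat).
Hypothesis wf : wf_layout adj D L free.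

Let static (v : T) : seq nat :=
  [:: vaddr L v; (vaddr L v).+1] ++ flatten [seq [:: q.1; q.1.+1] | q <- alist L v].

Lemma mem_row v a : (a \in iota (marr L v) D.+1) = (marr L v <= a <= marr L v + D).
Proof. by rewrite mem_iota addnS ltnS. Qed.

Lemma row_in_cells v a : a \in iota (marr L v) D.+1 -> a \in cells D L v.
Proof. by move=> h; rewrite /cells !mem_cat h !orbT. Qed.

Lemma static_in_cells v a : a \in static v -> a \in cells D L v.
Proof.
by rewrite /static /cells !mem_cat => /orP[->|->] //; rewrite ?orbT.
Qed.

Lemma cells_inj u v a : a \in cells D L u -> a \in cells D L v -> u = v.
Proof.
case: wf => /uniq_flatten_map[_ h] _ _.
by apply: h; rewrite mem_enum.
Qed.

Lemma static_row u v a : a \in static u -> a \notin iota (marr L v) D.+1.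
Proof.
move=> sa; apply/negP => ra.
have e := cells_inj (static_in_cells sa) (row_in_cells ra); subst v.
case: wf => /uniq_flatten_map[h _] _ _.
have := h u; rewrite mem_enum => /(_ isT).
rewrite /cells catA cat_uniq => /and3P[_ /hasPn/(_ _ ra) /negP[]].
by move: sa; rewrite /static.
Qed.

Lemma cells_range v a : a \in cells D L v -> D < a < free.
Proof. by case: wf => _ /(_ v) /allP h _ /h. Qed.

Lemma vaddr_range v : D < vaddr L v < free.
Proof. by apply: (@cells_range v); rewrite /cells /= mem_head. Qed.

Lemma vaddr_inj u v : vaddr L u = vaddr L v -> u = v.
Proof.
move=> e; apply: (@cells_inj _ _ (vaddr L u)); rewrite /cells /= ?mem_head //.
by rewrite e mem_head.
Qed.

Lemma row_range v i : i <= D -> D < marr L v + i < free.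
Proof.
move=> iD; apply: (@cells_range v); apply: row_in_cells; rewrite mem_row.
by rewrite leq_addr leq_add2l.
Qed.

(* [R v c] is the other end of the edge of color [c] at [v].  The two ends of an
   edge need not agree, so that the memory represents some [R] even in the middle
   of an update. *)
Definition rep (R : T -> 'I_D -> option T) (h : nat -> nat) : Prop :=
  forall v, [/\ list_at L h (h (vaddr L v)) (alist L v),
    h (vaddr L v).+1 = marr L v & row_ok (vaddr L) h (marr L v) (R v)].

Lemma list_at_eq h h' p l :
  (forall a, a \in flatten [seq [:: q.1; q.1.+1] | q <- l] -> h' a = h a) ->
  list_at L h p l -> list_at L h' p l.
Proof.
elim: l p => //= q l IHl p e [-> hq hl]; split=> //.
  by rewrite e ?mem_head.
rewrite e ?inE ?eqxx ?orbT //; apply: IHl => // a al.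
by apply: e; rewrite !inE al !orbT.
Qed.

Lemma rep_static h h' v :
  (forall a, a \in static v -> h' a = h a) ->
  list_at L h (h (vaddr L v)) (alist L v) -> h (vaddr L v).+1 = marr L v ->
  list_at L h' (h' (vaddr L v)) (alist L v) /\ h' (vaddr L v).+1 = marr L v.
Proof.
move=> e hl hv; rewrite !e ?inE ?eqxx ?orbT //; split=> //.
by apply: list_at_eq hl => a al; apply: e; rewrite !inE al !orbT.
Qed.

Lemma rep_free R h h' : (forall a, a < free -> h' a = h a) ->
  rep R h -> rep R h'.
Proof.
move=> e hr v; have [h1 h2 h3] := hr v.
have [|] := @rep_static h h' v _ h1 h2.
  by move=> a /static_in_cells/cells_range/andP[_ /e].
split=> //; apply: row_ok_eq h3 => i iD; apply: e.
by have /andP[] := row_range v iD.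
Qed.

(** Frame rule: the cells of distinct vertices being disjoint, writes inside one row leave all other
    objects represented. *)
Lemma rep_row R h h' v r :
  rep R h -> (forall a, ~~ (marr L v <= a <= marr L v + D) -> h' a = h a) ->
  row_ok (vaddr L) h' (marr L v) r -> rep (upr R v r) h'.
Proof.
move=> hr e hv u; have [h1 h2 h3] := hr u.
have [|] := @rep_static h h' u _ h1 h2.
  by move=> a /static_row-/(_ v); rewrite mem_row => /e.
split=> //; rewrite /upr; have [->//|uv] := eqVneq u v.
apply: row_ok_eq h3 => i iD; apply: e; rewrite -mem_row.
apply: contra uv => /row_in_cells cv; apply/eqP; apply: cells_inj cv.
by apply: row_in_cells; rewrite mem_row leq_addr leq_add2l.
Qed.

Lemma rep_ext R R' h : (forall v c, R v c = R' v c) -> rep R h -> rep R' h.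
Proof.
move=> e hr v; have [h1 h2 h3] := hr v; split=> //.
exact: row_ok_ext (e v) h3.
Qed.

Definition upR (R : T -> 'I_D -> option T) v c o := upr R v (upr (R v) c o).

Lemma upRE R v c o u d :
  upR R v c o u d = if (u == v) && (d == c) then o else R u d.
Proof.
rewrite /upR /upr; have [->|] := eqVneq u v => //=.
Qed.

Lemma rep_Some R h v c w : rep R h -> R v c = Some w ->
  h (marr L v + c.+1) = vaddr L w.
Proof. by move=> /(_ v)[_ _ [h1 _ _]] /h1. Qed.

(** Together with [vaddr_range] this justifies the constant-time test of the programs: an entry
    exceeds [D] exactly when it is an edge. *)
Lemma rep_None R h v c : rep R h -> R v c = None -> h (marr L v + c.+1) <= D.
Proof. by move=> /(_ v)[_ _ [_ _ h3]] /h3->; apply: next_code_le. Qed.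

Lemma rep_set R h v c w w' : rep R h -> R v c = Some w ->
  rep (upR R v c (Some w')) (upd h (marr L v + c.+1) (vaddr L w')).
Proof.
move=> hr rc; apply: (@rep_row _ h) => //.
  move=> a na; rewrite upd_neq //; apply: contra na => /eqP->.
  by have := ltn_ord c; lia.
by have [_ _ h3] := hr v; apply: row_set h3 rc.
Qed.

(** * Insertion and deletion in the lists of missing colors *)

(* Registers 20, 21 and 22 hold the address of a row, a color and the address
   of a vertex. *)
Definition fetch : cmd :=
  Seq (Assign 24 (Read (Reg 23)))
      (If (Eqn (Reg 24) (Cst 0)) (Assign 24 (Reg 21)) Skip).
(** As [fetch] replaces the end mark 0 by the color sought, a single comparison stops the loop both
    at the end of the list and at the first color that is not smaller. *)
Definition seek : cmd :=
  Seq (Assign 23 (Reg 20))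
  (Seq fetch
  (While (Leq (Add (Reg 24) (Cst 1)) (Reg 21))
     (Seq (Assign 23 (Add (Reg 20) (Reg 24))) fetch))).
Definition delete : cmd :=
  Seq seek
  (Seq (Write (Reg 23) (Read (Add (Reg 20) (Reg 21))))
       (Write (Add (Reg 20) (Reg 21)) (Reg 22))).
Definition insert : cmd :=
  Seq seek
  (Seq (Write (Add (Reg 20) (Reg 21)) (Read (Reg 23)))
       (Write (Reg 23) (Reg 21))).

Lemma runs_fetch s K (Q : state -> Prop) : 9 < K ->
  (forall s', frame 24 s s' -> heap s' = heap s ->
     regs s' 24 = (if heap s (regs s 23) == 0 then regs s 21
                   else heap s (regs s 23)) -> Q s') ->
  runs fetch s K Q.
Proof.
move=> hK hQ; step; apply: runs_if; rsimp; case e: (_ == 0).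
  apply: runs_assign => /=; first by lia.
  by apply: hQ; rsimp; rewrite ?e //; frame_tac.
apply: runs_skip => /=; first by lia.
by apply: hQ; rsimp; rewrite ?e //; frame_tac.
Qed.

Lemma runs_seek (r : 'I_D -> option T) s c :
  row_ok (vaddr L) (heap s) (regs s 20) r -> regs s 21 = c -> 0 < c ->
  runs seek s (30 * #|blank r| + 30) (fun s' =>
    [/\ frame 23 s s', heap s' = heap s
      & exists2 p, regs s' 23 = regs s 20 + p & is_prev (blank r) c p]).
Proof.
move=> hr hc c0; set A := blank r; set h := heap s; set m := regs s 20.
(* The number of missing colors beyond the current entry bounds the iterations left. *)
pose I n s' := [/\ frame 23 s s', heap s' = h & exists p,
  [/\ regs s' 23 = m + p, p < c, p = 0 \/ exists2 d : 'I_D, d \in A & p = d.+1,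
    regs s' 24 = (if next_code A p == 0 then c else next_code A p)
    & #|[set d in A | p < d.+1]| <= n]].
step; apply: (@runs_seq _ _ _ 10 (30 * #|A| + 15) _ (I #|A|)).
- apply: runs_fetch => // s' f e1 e2; split=> //.
    by move=> i lt; rewrite f; [frame_tac|lia].
  exists 0; rewrite addn0 f //; rsimp; split=> //; first by left.
    move: e2; rsimp; rewrite hc => ->.
    by have [_ -> _] := hr.
  by apply: subset_leq_card; apply/subsetP => d; rewrite inE => /andP[].
- move=> s1 I1.
  apply: runs_weaken
    (@runs_while_iter _ _ 16 I (fun s' =>
      [/\ frame 23 s s', heap s' = h
        & exists2 p, regs s' 23 = m + p & is_prev A c p]) _ _ _ _ I1)
    _ (fun s' x => x) => /=; last by lia.
  + move=> n s2 [f e [p [e1 pc hp e2 _]]] /=.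
    rewrite (f 21) // hc addn1 -ltnNge ltnS e2 => le; split=> //.
    exists p => //; split=> // d dA lt; rewrite leqNgt; apply/negP => pd.
    case: (next_codeP A p) le => [[_ /(_ _ dA)]|]; first by lia.
    by case=> [d0 [-> _ _ /(_ _ dA pd) le] /=]; lia.
  + move=> n s2 [f e [p [e1 pc hp e2 hn]]] /=.
    rewrite (f 21) // hc addn1 e2.
    case: (next_codeP A p) => [[-> _]|]; first by rewrite eqxx ltnn.
    case=> [d [ed dA pd hd]]; rewrite ed /= => dc.
    have lt : #|[set d0 in A | d.+1 < d0.+1]| < #|[set d in A | p < d.+1]|.
      apply: proper_card; apply/properP; split; last first.
        by exists d; rewrite inE dA ?pd ?ltnn.
      by apply/subsetP => x; rewrite inE [in X in _ -> X]inE => /andP[->] /=; lia.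
    split; first exact: leq_trans (leq_ltn_trans (leq0n _) lt) hn.
    have e24 : regs s2 24 = d.+1 by rewrite e2 ed.
    step; apply: runs_fetch => // s3 f3 e3.
    rsimp; rewrite (f 20) // (f 21) // -/m e e24 hc.
    rewrite (@row_ok_next _ _ _ h m r d.+1 hr); last by right; exists d.
    move=> e4; split=> //.
    * by move=> i lt'; rewrite f3; [frame_tac; apply: f; lia|lia].
    * by rewrite e3.
    exists d.+1; split=> //.
    * by rewrite f3 //; rsimp; rewrite f // e24.
    * by right; exists d.
    * by lia.
- by budget.
Qed.

Lemma is_prev_le (A : {set 'I_D}) c p : is_prev A c p -> c <= D -> p <= D.
Proof. by case=> lt _ _ le; apply: leq_trans (ltnW lt) le. Qed.

Lemma runs_delete R s v c w : rep R (heap s) -> R v c = None ->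
  regs s 20 = marr L v -> regs s 21 = c.+1 -> regs s 22 = vaddr L w ->
  runs delete s (30 * #|blank (R v)| + 60) (fun s' =>
    [/\ frame 20 s s', rep (upR R v c (Some w)) (heap s')
      & forall a, free <= a -> heap s' a = heap s a]).
Proof.
move=> hr rc e20 e21 e22; have [_ _ hv] := hr v; rewrite -e20 in hv.
apply: (@runs_seq _ _ _ _ 29) (runs_seek hv e21 isT) _ _; last by lia.
move=> s1 [f e [p e23 hp]]; step; apply: runs_write => //.
rsimp; rewrite (f 20) // (f 21) // (f 22) // e e23 e20 e21 e22.
have pD := is_prev_le hp (ltn_ord c); split.
- by move=> i lt; rewrite /= f //; lia.
- apply: rep_row hr _ _; last by rewrite -e20; apply: row_del.
  move=> a na; rewrite !upd_neq //.
    by apply: contra na => /eqP->; lia.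
  by apply: contra na => /eqP->; have := ltn_ord c; lia.
- move=> a fa; have := row_range v pD; have := row_range v (ltn_ord c).
  by move=> h1 h2; rewrite !upd_neq //; lia.
Qed.

Lemma runs_insert R s v c : rep R (heap s) -> R v c <> None ->
  regs s 20 = marr L v -> regs s 21 = c.+1 ->
  runs insert s (30 * #|blank (R v)| + 60) (fun s' =>
    [/\ frame 20 s s', rep (upR R v c None) (heap s')
      & forall a, free <= a -> heap s' a = heap s a]).
Proof.
move=> hr rc e20 e21; have [_ _ hv] := hr v; rewrite -e20 in hv.
apply: (@runs_seq _ _ _ _ 29) (runs_seek hv e21 isT) _ _; last by lia.
move=> s1 [f e [p e23 hp]]; step; apply: runs_write => //.
rsimp; rewrite (f 20) // (f 21) // e e23 e20 e21.
have pD := is_prev_le hp (ltn_ord c); split.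
- by move=> i lt; rewrite /= f //; lia.
- apply: rep_row hr _ _; last by rewrite -e20; apply: row_ins.
  move=> a na; rewrite !upd_neq //.
    by apply: contra na => /eqP->; have := ltn_ord c; lia.
  by apply: contra na => /eqP->; lia.
- move=> a fa; have := row_range v pD; have := row_range v (ltn_ord c).
  by move=> h1 h2; rewrite !upd_neq //; lia.
Qed.
End Layout.

(** * The fan search *)

(* Fan vertices are named by indices: [None] is [y], and [Some c] is the
   neighbor of [x] along the edge of color [c].  A pair [(k, c)] of [seen]
   records that the color [c] was first found missing at the vertex [k]; the
   queue is [seen] itself, [hd] is the position of the current vertex in
   [vertices] and [todo] the part of its list of missing colors that is still to
   be scanned. *)
Record fan D := Fan {
  seen : seq (option 'I_D * 'I_D);
  hd : nat;
  todo : seq 'I_D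
}.

Section Fan.
Variables (D : nat) (mx : {set 'I_D}) (mz : option 'I_D -> {set 'I_D}).
Implicit Types (F : fan D) (sn : seq (option 'I_D * 'I_D)).

Definition colors sn : seq 'I_D := [seq p.2 | p <- sn].
(** Position 0 is [y], so the vertex reached by the color at position [i] of [sn] is at position
    [i.+1]. *)
Definition vertices sn : seq (option 'I_D) := None :: [seq Some c | c <- colors sn].
Definition current F : option 'I_D := nth None (vertices (seen F)) (hd F).

(* [Some false]: the head of [todo] is missing at [x] too; [Some true]: it is
   missing at another fan vertex. *)
Definition status F : option bool :=
  if todo F is c :: _ then
    if c \in mx then Some false
    else if c \in colors (seen F) then Some true else None
  else None.

(** A conflict makes the state stationary. Iterating often enough thus amounts to stopping at the
    first conflict, and the outcome is a plain function of [mx] and [mz]. *)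
Definition fan_step F : fan D :=
  match todo F with
  | [::] => Fan (seen F) (hd F).+1
              (enum (mz (nth None (vertices (seen F)) (hd F).+1)))
  | c :: t => if (c \in mx) || (c \in colors (seen F)) then F
              else Fan (rcons (seen F) (current F, c)) (hd F) t
  end.

Definition fan_start : fan D := Fan [::] 0 (enum (mz None)).

(** Until a conflict each step adds one to the sum of [size (seen F)] and [hd F], both at most
    [D]. *)
Definition fan_end : fan D := iter (D + D).+1 fan_step fan_start.

(** For a list with the newest pair first: every color was found at [y] or at a vertex reached by an
    older color, so ancestry is well founded. *)
Fixpoint sprung sn : Prop :=
  match sn with
  | [::] => True
  | p :: sn' => p.1 \in vertices sn' /\ sprung sn'
  end.

Definition scanned (ks : seq (option 'I_D)) : seq (option 'I_D * 'I_D) :=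
  flatten [seq [seq (k, c) | c <- enum (mz k)] | k <- ks].

(** The last clause is an exact equality of sequences: the counting argument and the cost bound of a
    chain both take sizes in it, and the distinctness of pairs is read off from it. *)
Definition fan_inv F : Prop :=
  [/\ uniq (colors (seen F)), {in colors (seen F), forall c, c \notin mx},
      hd F <= size (seen F), sprung (rev (seen F)) /\ uniq (todo F)
    & seen F ++ [seq (current F, c) | c <- todo F]
      = scanned (take (hd F).+1 (vertices (seen F)))].

Lemma size_vertices sn : size (vertices sn) = (size sn).+1.
Proof. by rewrite /= !size_map. Qed.

Lemma vertices_rcons sn k c : vertices (rcons sn (k, c)) = rcons (vertices sn) (Some c).
Proof. by rewrite /vertices /colors !map_rcons. Qed.

Lemma mem_vertices_rev sn : vertices (rev sn) =i vertices sn.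
Proof.
by move=> k; rewrite /vertices /colors !map_rev !inE mem_rev.
Qed.

Lemma size_scanned ks : size (scanned ks) = \sum_(k <- ks) #|mz k|.
Proof.
rewrite size_flatten /shape -map_comp sumnE big_map.
by apply: eq_bigr => k _; rewrite /= size_map -cardE.
Qed.

Lemma mem_scanned ks k c : ((k, c) \in scanned ks) = (k \in ks) && (c \in mz k).
Proof.
apply/flatten_mapP/andP => [[k' k's /mapP[c' c's [-> ->]]]|[ks' cm]].
  by rewrite mem_enum in c's.
by exists k => //; apply: map_f; rewrite mem_enum.
Qed.

Lemma size_colors sn : uniq (colors sn) -> size sn <= D.
Proof.
move=> /card_uniqP; rewrite size_map => <-.
by rewrite -[X in _ <= X]card_ord max_card.
Qed.

(* Once the lists of all fan vertices are scanned without any conflict, every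
   fan vertex but [y] comes from one missing color of one fan vertex. *)
Hypothesis enough : forall cs : seq 'I_D, uniq cs ->
  {in cs, forall c, c \notin mx} ->
  size cs < \sum_(k <- None :: [seq Some c | c <- cs]) #|mz k|.

Lemma fan_inv_start : fan_inv fan_start.
Proof.
by split=> //=; rewrite ?enum_uniq //; rewrite /scanned /= cats0.
Qed.

Lemma fan_step_inv F : fan_inv F -> status F = None ->
  fan_inv (fan_step F) /\
  size (seen (fan_step F)) + hd (fan_step F) = (size (seen F) + hd F).+1.
Proof.
case: F => sn h td [/= un nx hs [sp ut] e]; rewrite /status /fan_step /=.
case: td ut e => [|c t] ut e; last first.
  case: ifP => // cx; case: ifP => // cs _ /=; split; last first.
    by rewrite size_rcons addSn.
  have cur : current (Fan (rcons sn (current (Fan sn h (c :: t)), c)) h t)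
      = current (Fan sn h (c :: t)).
    by rewrite /current; cbn [seen hd]; rewrite vertices_rcons nth_rcons size_vertices ltnS hs.
  split; cbn [seen hd todo].
  - by rewrite /colors map_rcons rcons_uniq -/(colors _) cs.
  - move=> d; rewrite /colors map_rcons mem_rcons inE => /orP[/eqP->|/nx //].
    by rewrite cx.
  - by rewrite size_rcons; apply: leqW.
  - split; last by case/andP: ut.
    rewrite rev_rcons /=; split=> //; rewrite mem_vertices_rev /current /=.
    by apply: mem_nth; rewrite size_vertices.
  - rewrite cur cat_rcons vertices_rcons.
    rewrite -cats1 takel_cat; first by rewrite -e.
    by rewrite size_vertices.
(* With an exhausted queue, all fan vertices would be scanned and [sn] would have as many pairs as
   they have missing colors in total, against [enough]. *)
move=> _; have hlt : h < size sn.
  rewrite ltn_neqAle hs andbT; apply/eqP => hE.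
  have := enough un nx; rewrite -/(vertices sn) size_map.
  rewrite -size_scanned; move: e; rewrite cats0 hE take_oversize.
    by move=> <-; rewrite ltnn.
  by rewrite !size_map.
split; last by rewrite /= addnS.
split; cbn [seen hd todo] => //; first by rewrite enum_uniq.
rewrite cats0 in e; rewrite /current; cbn [seen hd].
rewrite (take_nth None) ?size_vertices ?ltnS // /scanned map_rcons flatten_rcons.
by rewrite -/(scanned _) -e.
Qed.

Lemma fan_step_done F : status F != None -> fan_step F = F.
Proof.
rewrite /status /fan_step; case: (todo F) => // c t.
by case: ifP => // _; case: ifP.
Qed.

Lemma fan_end_done : fan_inv fan_end /\ status fan_end != None.
Proof.
rewrite /fan_end.
have h n : fan_inv (iter n fan_step fan_start) /\
    (status (iter n fan_step fan_start) = None ->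
     n <= size (seen (iter n fan_step fan_start)) + hd (iter n fan_step fan_start)).
  elim: n => [|n [IH1 IH2]]; first by split=> //; exact: fan_inv_start.
  rewrite iterS; case e : (status (iter n fan_step fan_start)) => [b|].
    by rewrite fan_step_done ?e.
  by have [i1 ->] := fan_step_inv IH1 e; split=> // _; rewrite ltnS IH2.
have [inv le] := h (D + D).+1; split=> //; apply/eqP => /le.
case: inv => /size_colors hD _ hs _ _; lia.
Qed.

Lemma fan_iter_end n : status (iter n fan_step fan_start) != None ->
  n <= (D + D).+1 -> iter n fan_step fan_start = fan_end.
Proof.
move=> hn le; rewrite /fan_end -(subnK le) iterD.
by elim: (_ - n) => //= m <-; rewrite fan_step_done.
Qed.

(* [l] lists the colors of the edges from [x] to the fan vertex [k] and to its
   ancestors other than [y]. *)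
Fixpoint chain sn (k : option 'I_D) (l : seq 'I_D) : Prop :=
  match l with
  | [::] => k = None
  | c :: l' => k = Some c /\ exists2 k', (k', c) \in sn & chain sn k' l'
  end.

Lemma chain_sub sn sn' k l : {subset sn <= sn'} -> chain sn k l -> chain sn' k l.
Proof.
move=> s; elim: l k => //= c l IHl k [-> [k' k's ch]]; split=> //.
by exists k'; [apply: s|apply: IHl].
Qed.

(** Parents are older than children, so the induction on the list descends to [y], and the
    distinctness of the colors keeps the chain free of repetitions. *)
Lemma chain_exists sn k : uniq (colors sn) -> sprung sn -> k \in vertices sn ->
  exists l, [/\ chain sn k l, uniq l & {subset l <= colors sn}].
Proof.
elim: sn k => [|[k0 c0] sn IHsn] k /=.
  by rewrite inE => _ _ /eqP->; exists [::].
case/andP => c0s us [k0s sp]; rewrite inE => /orP[/eqP->|].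
  by exists [::].
rewrite inE => /orP[/eqP->|ks]; last first.
  have [|l [ch ul ls]] := IHsn k us sp; first by rewrite inE ks orbT.
  exists l; split=> //; first by apply: chain_sub ch => p ps; rewrite inE ps orbT.
  by move=> c /ls cs; rewrite inE cs orbT.
have [l [ch ul ls]] := IHsn k0 us sp k0s.
exists (c0 :: l); split=> //=.
- split=> //; exists k0; first by rewrite mem_head.
  by apply: chain_sub ch => p ps; rewrite inE ps orbT.
- by rewrite ul andbT; apply: contra c0s => /ls.
- by move=> c; rewrite !inE => /orP[->//|/ls ->]; rewrite orbT.
Qed.

(** The vertex [k] was reached before [c] was recorded, so its chain has only older colors. *)
Lemma chain_exists_before sn k c : uniq (colors sn) -> sprung sn -> (k, c) \in sn ->
  exists l, [/\ chain sn k l, uniq l, {subset l <= colors sn} & c \notin l].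
Proof.
elim: sn => [|[k0 c0] sn IHsn] //= /andP[c0s us] [k0s sp].
rewrite inE => /orP[/eqP[-> ->]|kc].
  have [l [ch ul ls]] := chain_exists us sp k0s.
  exists l; split=> //.
  - by apply: chain_sub ch => p ps; rewrite inE ps orbT.
  - by move=> d /ls ds; rewrite inE ds orbT.
  - by apply: contra c0s => /ls.
have [l [ch ul ls cl]] := IHsn us sp kc; exists l; split=> //.
- by apply: chain_sub ch => p ps; rewrite inE ps orbT.
- by move=> d /ls ds; rewrite inE ds orbT.
Qed.

Lemma chain_mem sn k l (ks : seq (option 'I_D)) : chain sn k l -> k \in ks ->
  (forall p, p \in sn -> p.1 \in ks) -> {subset [seq Some c | c <- l] <= ks}.
Proof.
move=> ch kk h; elim: l k ch kk => [|c l IHl] k //= [-> [k' k's ch]] ck d.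
by rewrite inE => /orP[/eqP->//|]; apply: IHl ch (h _ k's) d.
Qed.

Definition chain_cost (l : seq 'I_D) : nat :=
  \sum_(k <- None :: [seq Some c | c <- l]) #|mz k|.+1.

Lemma sum_uniq_sub (I : eqType) (s t : seq I) (f : I -> nat) :
  uniq s -> {subset s <= t} -> \sum_(i <- s) f i <= \sum_(i <- t) f i.
Proof.
elim: s t => [|i s IHs] t; first by rewrite big_nil.
move=> /= /andP[si us] st; have it : i \in t by apply: st; rewrite mem_head.
rewrite big_cons (perm_big _ (perm_to_rem it)) big_cons leq_add2l /=.
apply: IHs => // j js; have jt : j \in t by apply: st; rewrite inE js orbT.
have := perm_mem (perm_to_rem it) j; rewrite jt inE => /esym.
by case: eqP => [e|] //; rewrite -e js in si.
Qed.

(* The colors in [seen] are distinct, so that the lists of the fan vertices that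
   are completely scanned are pairwise disjoint. *)
Lemma chain_cost_le F k l : fan_inv F -> k \in take (hd F).+1 (vertices (seen F)) ->
  chain (seen F) k l -> uniq l -> chain_cost l <= 3 * D + 1 + D.
Proof.
move=> [un _ hs [_ ut] e] kk ch ul; set ks := take _ _ in e kk.
have sub : {subset None :: [seq Some c | c <- l] <= ks}.
  move=> k'; rewrite inE => /orP[/eqP->|]; first by rewrite /ks /= mem_head.
  (* A vertex recorded as a parent has been scanned, so it lies among the vertices up to the
     head. *)
  apply: chain_mem ch kk _ k' => -[k1 c1] p1.
  have : (k1, c1) \in scanned ks by rewrite -e mem_cat p1.
  by rewrite mem_scanned => /andP[].
have uks : uniq (None :: [seq Some c | c <- l]).
  rewrite /= map_inj_uniq ?ul ?andbT; last by move=> a b [].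
  by apply/mapP => -[].
apply: leq_trans (sum_uniq_sub _ uks sub) _.
under eq_bigr do rewrite -addn1.
rewrite big_split /= sum1_size -size_scanned -e size_cat size_map.
(* There are at most [D.+1] vertices up to the head; the pairs seen and the colors still to scan
   number at most [D] each. *)
have h1 : size ks <= D.+1.
  by rewrite size_take size_vertices ltnS; have := size_colors un; case: ifP; lia.
have h2 := size_colors un.
have h3 : size (todo F) <= D.
  by move/card_uniqP: ut => <-; rewrite -[X in _ <= X]card_ord max_card.
lia.
Qed.

End Fan.

(** * Colorings as systems of partial matchings *)

Lemma set2_eq (T : finType) (u v u' v' : T) :
  [set u; v] = [set u'; v'] -> (u = u' /\ v = v') \/ (u = v' /\ v = u').
Proof.
move=> e.
have /set2P hu : u \in [set u'; v'] by rewrite -e set21.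
have /set2P hv : v \in [set u'; v'] by rewrite -e set22.
have /set2P hu' : u' \in [set u; v] by rewrite e set21.
have /set2P hv' : v' \in [set u; v] by rewrite e set22.
by intuition congruence.
Qed.

Section System.
Variables (T : finType) (adj : rel T) (D : nat).
Hypotheses (adjC : symmetric adj) (adjN : irreflexive adj).
Implicit Types (R : T -> 'I_D -> option T) (pi : coloring T D).

(** One partial matching per color. That edges of the same color do not meet is built into [R v c]
    being a single vertex; it remains to ask that the two ends of an edge agree and that an edge has
    one color. *)
Definition valid R : Prop :=
  (forall v c w, R v c = Some w -> adj v w /\ R w c = Some v) /\
  (forall v c c' w, R v c = Some w -> R v c' = Some w -> c = c').

Definition system_of pi (v : T) (c : 'I_D) : option T :=
  [pick w | adj v w && (pi [set v; w] == Some c)].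

Definition coloring_of R : coloring T D :=
  [ffun e => [pick c | [exists u, exists v, (e == [set u; v]) && (R u c == Some v)]]].

Lemma edgeP (e : {set T}) :
  reflect (exists u v, adj u v /\ e = [set u; v]) (e \in edges adj).
Proof.
rewrite inE; apply: (iffP existsP) => [[u /existsP[v /andP[a /eqP->]]]|[u [v [a ->]]]].
  by exists u, v.
by exists u; apply/existsP; exists v; rewrite a eqxx.
Qed.

Lemma system_ofP pi v c w : partial_coloring adj pi ->
  system_of pi v c = Some w <-> adj v w /\ pi [set v; w] = Some c.
Proof.
move=> [_ h]; rewrite /system_of; case: pickP => [w' /andP[a' /eqP p']|no].
  split=> [[<-] //|[a p]]; congr Some; apply/eqP/negPn/negP => ne.
  have : c != c; last by rewrite eqxx.
  apply: (h [set v; w'] [set v; w] _ _ _ _ p' p).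
    apply: contra ne => /eqP/set2_eq[[_ ->] //|[e1 e2]].
    by rewrite e2 -e1.
  by apply/set0Pn; exists v; rewrite !inE !eqxx.
by split=> // -[a p]; have := no w; rewrite a p eqxx.
Qed.

Lemma valid_system_of pi : partial_coloring adj pi -> valid (system_of pi).
Proof.
move=> hp; split=> [v c w /(system_ofP _ _ _ hp)[a p]|v c c' w].
  by split=> //; apply/(system_ofP _ _ _ hp); rewrite adjC setUC.
by move=> /(system_ofP _ _ _ hp)[_ p] /(system_ofP _ _ _ hp)[_]; rewrite p => -[].
Qed.

Lemma coloring_ofP R e c : valid R ->
  coloring_of R e = Some c <-> exists u v, e = [set u; v] /\ R u c = Some v.
Proof.
move=> [h1 h2]; rewrite ffunE; case: pickP => [c'|no]; last first.
  split=> // -[u [v [ee r]]].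
  have : [exists u, exists v, (e == [set u; v]) && (R u c == Some v)].
    by apply/existsP; exists u; apply/existsP; exists v; rewrite ee r !eqxx.
  by have := no c; rewrite /= => ->.
move=> /existsP[u' /existsP[v' /andP[/eqP-> /eqP r']]].
split=> [[<-]|[u [v [/set2_eq ee r]]]]; first by exists u', v'.
case: ee => [[e1 e2]|[e1 e2]]; subst; congr Some; first exact: h2 r' r.
by have [_ r2] := h1 _ _ _ r; apply: h2 r' r2.
Qed.

Lemma coloring_of_edge R u v c : valid R ->
  coloring_of R [set u; v] = Some c <-> R u c = Some v.
Proof.
move=> hR; rewrite coloring_ofP //; split=> [[u' [v' [/set2_eq e r]]]|r].
  by case: e => [[-> ->] //|[-> ->]]; have [_] := hR.1 _ _ _ r.
by exists u, v.
Qed.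

Lemma partial_coloring_of R : valid R -> partial_coloring adj (coloring_of R).
Proof.
move=> hR; split.
  apply/subsetP => e; rewrite inE; case p : (coloring_of R e) => [c|] // _.
  move/coloring_ofP: p => /(_ hR)[u [v [-> r]]]; apply/edgeP; exists u, v.
  by have [] := hR.1 _ _ _ r.
move=> e f ef /set0Pn[v]; rewrite inE => /andP[ve vf] c d.
move=> /(coloring_ofP _ _ hR)[u1 [v1 [e1 r1]]] /(coloring_ofP _ _ hR)[u2 [v2 [e2 r2]]].
apply: contra ef => /eqP cd; subst d; apply/eqP.
have inc u w : v \in [set u; w] -> R u c = Some w ->
    exists2 t, [set u; w] = [set v; t] & R v c = Some t.
  rewrite !inE => /orP[/eqP-> r|/eqP-> r]; first by exists w.
  by have [_ r'] := hR.1 _ _ _ r; exists u => //; rewrite setUC.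
rewrite e1 in ve *; rewrite e2 in vf *.
have [t1 -> r3] := inc _ _ ve r1; have [t2 -> r4] := inc _ _ vf r2.
by congr [set v; _]; move: r3; rewrite r4 => -[].
Qed.

Lemma system_ofK R v c : valid R -> system_of (coloring_of R) v c = R v c.
Proof.
move=> hR; have hp := partial_coloring_of hR.
case r : (R v c) => [w|].
  apply/(system_ofP _ _ _ hp); split; first by have [] := hR.1 _ _ _ r.
  by apply/coloring_of_edge.
case e : (system_of _ v c) => [w|//].
by move/(system_ofP _ _ _ hp): e => [_ /(coloring_of_edge _ _ _ hR)]; rewrite r.
Qed.

Lemma coloring_ofK pi : partial_coloring adj pi -> coloring_of (system_of pi) = pi.
Proof.
move=> hp; have hR := valid_system_of hp; apply/ffunP => e.
case p : (pi e) => [c|].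
  apply/(coloring_ofP _ _ hR); have /edgeP[u [v [a ee]]] : e \in edges adj.
    by apply: (subsetP hp.1); rewrite inE p.
  by exists u, v; split=> //; apply/(system_ofP _ _ _ hp); rewrite -ee.
case q : (coloring_of _ e) => [c|//].
move/(coloring_ofP _ _ hR): q => [u [v [ee]]].
by move=> /(system_ofP _ _ _ hp)[_]; rewrite -ee p.
Qed.

Lemma missingE pi v : missing adj pi v = blank (system_of pi v).
Proof.
apply/setP => c; rewrite !inE /system_of; case: pickP => [w /andP[a p]|no].
  by apply/negbF/existsP; exists w; rewrite inE a p.
apply/negP => /existsP[w]; rewrite inE => /andP[a p].
by have := no w; rewrite a p.
Qed.

Lemma representsE L pi h : partial_coloring adj pi ->
  represents adj L pi h <-> rep L (system_of pi) h.
Proof.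
move=> hp; split=> hr v.
  have [h1 h2 h3 h4 h5] := hr v; split=> //; split.
  - by move=> c w /(system_ofP _ _ _ hp)[a p]; apply: h3.
  - by rewrite h4 missingE.
  - by move=> c e; rewrite h5 missingE // inE e.
have [h1 h2 [h3 h4 h5]] := hr v; split=> //.
- by move=> w c a p; apply: h3; apply/(system_ofP _ _ _ hp).
- by rewrite h4 missingE.
- by move=> c; rewrite missingE inE => /eqP/h5.
Qed.

Lemma coloredP R (e : {set T}) : valid R ->
  reflect (exists u v c, e = [set u; v] /\ R u c = Some v)
    (e \in colored (coloring_of R)).
Proof.
move=> hR; rewrite inE; case p : (coloring_of R e) => [c|]; constructor.
  by move/(coloring_ofP _ _ hR): p => [u [v [ee r]]]; exists u, v, c.
move=> [u [v [c [ee r]]]]; have : coloring_of R e = Some c; last by rewrite p.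
by apply/(coloring_ofP _ _ hR); exists u, v.
Qed.

(** * Recoloring an edge and rotating a fan *)

(** Here [oc] stands for the former color of the edge, [None] if it was uncolored. *)
Definition recolor R (x z : T) (oc : option 'I_D) (d : 'I_D) u e : option T :=
  if u == x then
    if e == d then Some z else if Some e == oc then None else R x e
  else if u == z then
    if e == d then Some x else if Some e == oc then None else R z e
  else R u e.

Lemma valid_recolor R x z oc d : valid R -> adj x z ->
  R x d = None -> R z d = None -> (forall e, R x e = Some z <-> oc = Some e) ->
  valid (recolor R x z oc d).
Proof.
move=> [h1 h2] a xd zd hoc.
have xz : x != z by apply/eqP => e; rewrite e adjN in a.
have zx : (z == x) = false by rewrite eq_sym (negbTE xz).
have hoc' e : R z e = Some x <-> oc = Some e.
  by rewrite -hoc; split=> /h1[].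
split=> [v c w|v c c' w]; rewrite /recolor.
  have [->|vx] := eqVneq v x.
    have [->|cd] := eqVneq c d; first by case=> <-; rewrite zx !eqxx.
    have [//|co] := eqVneq (Some c) oc => r; have [aw r'] := h1 _ _ _ r.
    have [e|wx] := eqVneq w x; first by move: aw; rewrite e adjN.
    have [e|wz] := eqVneq w z.
      by move: r; rewrite e => /hoc e'; rewrite e' eqxx in co.
    by rewrite r'.
  have [->|vz] := eqVneq v z.
    have [->|cd] := eqVneq c d; first by case=> <-; rewrite !eqxx adjC.
    have [//|co] := eqVneq (Some c) oc => r; have [aw r'] := h1 _ _ _ r.
    have [e|wx] := eqVneq w x.
      by move: r; rewrite e => /hoc' e'; rewrite e' eqxx in co.
    have [e|wz] := eqVneq w z; first by move: aw; rewrite e adjN.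
    by rewrite r'.
  move=> r; have [aw r'] := h1 _ _ _ r.
  have [e|wx] := eqVneq w x.
    subst w; have [e|cd] := eqVneq c d; first by rewrite e xd in r'.
    have [e|co] := eqVneq (Some c) oc; last by [].
    by move: r'; have /hoc -> := esym e => -[e2]; rewrite e2 eqxx in vz.
  have [e|wz] := eqVneq w z; last by [].
  subst w; have [e|cd] := eqVneq c d; first by rewrite e zd in r'.
  have [e|co] := eqVneq (Some c) oc; last by [].
  by move: r'; have /hoc' -> := esym e => -[e2]; rewrite e2 eqxx in vx.
have [vx|vx] := eqVneq v x.
  have [->|cd] := eqVneq c d; have [->|cd'] := eqVneq c' d => //.
  - by case=> <-; have [//|co] := eqVneq (Some c') oc => /hoc e; rewrite e eqxx in co.
  - by have [//|co] := eqVneq (Some c) oc => r [e];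
    move: r; rewrite -e => /hoc e'; rewrite e' eqxx in co.
  by case: ifP => // _ r; case: ifP => // _ r'; apply: h2 r r'.
have [vz|vz] := eqVneq v z; last exact: h2.
have [->|cd] := eqVneq c d; have [->|cd'] := eqVneq c' d => //.
- by case=> <-; have [//|co] := eqVneq (Some c') oc => /hoc' e; rewrite e eqxx in co.
- by have [//|co] := eqVneq (Some c) oc => r [e];
  move: r; rewrite -e => /hoc' e'; rewrite e' eqxx in co.
by case: ifP => // _ r; case: ifP => // _ r'; apply: h2 r r'.
Qed.

Lemma recolor_far R x z oc d v : v != x -> v != z -> recolor R x z oc d v =1 R v.
Proof. by move=> vx vz c; rewrite /recolor (negbTE vx) (negbTE vz). Qed.

Definition joined R u v : Prop := exists c, R u c = Some v.

Lemma recolor_joined R x z oc d u v : valid R -> adj x z ->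
  R x d = None -> R z d = None -> (forall e, R x e = Some z <-> oc = Some e) ->
  joined (recolor R x z oc d) u v <-> joined R u v \/ [set u; v] = [set x; z].
Proof.
move=> hR a xd zd hoc; have [h1 h2] := hR.
have xz : x != z by apply/eqP => e; rewrite e adjN in a.
have zx : (z == x) = false by rewrite eq_sym (negbTE xz).
have hoc' e : R z e = Some x <-> oc = Some e.
  by rewrite -hoc; split=> /h1[].
split.
  case=> c; rewrite /recolor.
  have [->|vx] := eqVneq u x.
    have [_ [<-]|_] := eqVneq c d; first by right.
    by case: ifP => // _ r; left; exists c.
  have [->|vz] := eqVneq u z.
    have [_ [<-]|_] := eqVneq c d; first by right; rewrite setUC.
    by case: ifP => // _ r; left; exists c.
  by move=> r; left; exists c.
case=> [[c r]|/set2_eq[[-> ->]|[-> ->]]]; last 2 first.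
- by exists d; rewrite /recolor !eqxx.
- by exists d; rewrite /recolor zx !eqxx.
have [ux|ux] := eqVneq u x.
  have [vz|vz] := eqVneq v z; first by exists d; rewrite /recolor ux vz !eqxx.
  exists c; rewrite /recolor ux eqxx; have [e|_] := eqVneq c d.
    by rewrite -e -ux r in xd.
  have [e|_] := eqVneq (Some c) oc; last by rewrite -ux.
  by move: r; rewrite ux; have /hoc -> := esym e => -[e']; rewrite e' eqxx in vz.
have [uz|uz] := eqVneq u z; last by exists c; rewrite recolor_far.
have [vx|vx] := eqVneq v x; first by exists d; rewrite /recolor uz vx zx !eqxx.
exists c; rewrite /recolor uz zx eqxx; have [e|_] := eqVneq c d.
  by rewrite -e -uz r in zd.
have [e|_] := eqVneq (Some c) oc; last by rewrite -uz.
by move: r; rewrite uz; have /hoc' -> := esym e => -[e']; rewrite e' eqxx in vx.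
Qed.

Lemma recolor_keep R x z oc d u v c : valid R -> adj x z -> u != x -> v != x ->
  R z d = None -> (forall e, R x e = Some z <-> oc = Some e) ->
  recolor R x z oc d u c = Some v <-> R u c = Some v.
Proof.
move=> [h1 h2] a ux vx zd hoc; rewrite /recolor (negbTE ux).
have [->|//] := eqVneq u z; have [->|_] := eqVneq c d.
  by rewrite zd; split=> // -[e]; rewrite e eqxx in vx.
have [e|//] := eqVneq (Some c) oc; split=> // r.
by have /hoc/h1[_] := esym e; rewrite r => -[e']; rewrite e' eqxx in vx.
Qed.

(* [l] lists the colors of the fan edges, last fan edge first. *)
Fixpoint springs R x y d (l : seq 'I_D) : Prop :=
  match l with
  | [::] => R y d = None
  | c :: l' => exists z, [/\ R x c = Some z, R z d = None & springs R x y c l']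
  end.

(** Working from the far end towards [y] keeps every intermediate system valid: once [d] replaces
    [c] on an edge, [c] is free at [x], and the parent misses it. *)
Fixpoint rotate R x y d (l : seq 'I_D) : T -> 'I_D -> option T :=
  match l with
  | [::] => recolor R x y None d
  | c :: l' => if R x c is Some z then
      rotate (recolor R x z (Some c) d) x y c l' else R
  end.

Lemma springs_eq R R' x y d l :
  (forall c, c \in l -> R' x c = R x c) ->
  (forall c z, c \in l -> R x c = Some z -> R' z =1 R z) -> R' y =1 R y ->
  springs R x y d l -> springs R' x y d l.
Proof.
elim: l d => [|c l IHl] d e1 e2 e3 /=; first by rewrite e3.
case=> z [r rd hl]; exists z; rewrite e1 ?mem_head //; split=> //.
  by rewrite (e2 c) ?mem_head.
apply: IHl => // [c' cl|c' z' cl]; first by apply: e1; rewrite inE cl orbT.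
by apply: e2; rewrite inE cl orbT.
Qed.

Definition rotatable R x y d (l : seq 'I_D) : Prop :=
  [/\ valid R, adj x y /\ R x d = None, forall c, R x c <> Some y, uniq l
    & springs R x y d l].

Lemma springs_in R x y d l c : springs R x y d l -> c \in l -> R x c <> None.
Proof.
elim: l d => //= c' l IHl d [z [r _ hl]].
by rewrite inE => /orP[/eqP->|/(IHl _ hl)//]; rewrite r.
Qed.

(** The recoloring changes only the row of [z] and the entries [c] and [d] of [x]. The rest of the
    chain involves other colors at [x] and other vertices, so it still springs from [y]. *)
Lemma rotatable_step R x y d c l z : rotatable R x y d (c :: l) -> R x c = Some z ->
  [/\ rotatable (recolor R x z (Some c) d) x y c l, R z d = None,
      (forall e, R x e = Some z <-> Some c = Some e),
      adj x z & z != y] /\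
   (forall e z', e \in l -> R x e = Some z' -> z' != x /\ z' != z).
Proof.
move=> [hR [xy' xd] xy /= /andP[cl ul] [z' [r' zd hl]]] r.
move: r'; rewrite r => -[e]; subst z'; have [h1 h2] := hR.
have [a r'] := h1 _ _ _ r.
have xz : x != z by apply/eqP => e; rewrite e adjN in a.
have zx : (z == x) = false by rewrite eq_sym (negbTE xz).
have zy : z != y by apply/eqP => e; subst z; apply: xy r.
have hoc e : R x e = Some z <-> Some c = Some e.
  by split=> [r2|[<-] //]; rewrite (h2 _ _ _ _ r r2).
have cd : c != d by apply/eqP => e; rewrite -e r in xd.
have far e z' : e \in l -> R x e = Some z' -> z' != x /\ z' != z.
  move=> el re; split; apply/eqP => ez; subst z'.
    by have [] := h1 _ _ _ re; rewrite adjN.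
  by move/hoc: re => [e']; rewrite -e' (negbTE cl) in el.
split=> //; split=> //; split=> //.
- exact: valid_recolor.
- by rewrite /recolor eqxx (negbTE cd) eqxx.
- move=> e; rewrite /recolor eqxx; case: ifP => _.
    by case=> e2; rewrite e2 eqxx in zy.
  by case: ifP => _ //; apply: xy.
- have yx : y != x by apply/eqP => e; rewrite e adjN in xy'.
  apply: (springs_eq _ _ _ hl).
  + move=> e el; rewrite /recolor eqxx.
    have ed : e != d.
      by apply: contraPneq (springs_in hl el) => ->.
    rewrite (negbTE ed); case: eqP => // -[e2].
    by rewrite -e2 el in cl.
  + by move=> e z' el /(far _ _ el)[n1 n2]; apply: recolor_far.
  + by apply: recolor_far; rewrite // eq_sym.
Qed.

(** After validity, the clauses are the contributions of the rotation to (V3), to (V2) and to the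
    set of colored edges. *)
Lemma rotate_spec R x y d l : rotatable R x y d l ->
  [/\ valid (rotate R x y d l),
      forall v, v != x -> ~~ adj x v -> rotate R x y d l v =1 R v,
      forall u v c, u != x -> v != x ->
        rotate R x y d l u c = Some v <-> R u c = Some v
    & forall u v, joined (rotate R x y d l) u v <->
        joined R u v \/ [set u; v] = [set x; y]].
Proof.
elim: l R d => [|c l IHl] R d hR.
  have [h1 [a xd] xy _ /= yd] := hR.
  have hoc e : R x e = Some y <-> None = Some e by split=> // /xy.
  split.
  - exact: valid_recolor.
  - by move=> v vx av; apply: recolor_far => //; apply: contra av => /eqP->.
  - by move=> u v c ux vx; apply: recolor_keep.
  - by move=> u v; apply: recolor_joined.
have [_ _ _ _ [z [r zd _]]] := hR; rewrite /= r.
have [[hR' _ hoc [a zy]] _] := rotatable_step hR r.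
have [h1 [xy xd] _ _ _] := hR; have [i1 i2 i3 i4] := IHl _ _ hR'; split=> //.
- move=> v vx av e; rewrite i2 // recolor_far //.
  by apply: contra av => /eqP->.
- by move=> u v e ux vx; rewrite i3 // recolor_keep.
- move=> u v; rewrite i4 recolor_joined //.
  split=> [[[]|]|[]]; [by left| |by right|by left; left|by right].
  move=> e; left; case/set2_eq: e => [[-> ->]|[-> ->]]; exists c => //.
  by have [] := h1.1 _ _ _ r.
Qed.

End System.

(** * Alternating paths *)

Section Kempe.
Variables (T : finType) (adj : rel T) (D : nat).
Hypotheses (adjC : symmetric adj) (adjN : irreflexive adj).
Variable R : T -> 'I_D -> option T.
Hypothesis hR : valid adj R.
Implicit Types (p q a b : 'I_D) (s : seq T).

Fixpoint alt_walk p q v s : Prop :=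
  match s with
  | [::] => True
  | w :: s' => R v p = Some w /\ alt_walk q p w s'
  end.

(** Unlike [alt_walk], this one stops only where the color due next is missing, so it is maximal at
    its far end. *)
Fixpoint walk p q v s : Prop :=
  match s with
  | [::] => R v p = None
  | w :: s' => R v p = Some w /\ walk q p w s'
  end.

Lemma walk_alt p q v s : walk p q v s -> alt_walk p q v s.
Proof. by elim: s p q v => //= w s IHs p q v [? /IHs]. Qed.

Lemma walk_maximal p q v s t : walk p q v s -> alt_walk p q v (s ++ t) -> t = [::].
Proof.
elim: s p q v => [|w s IHs] p q v /=; last by move=> [_ h] [_]; apply: IHs h.
by move=> e; case: t => //= w t [e']; rewrite e in e'.
Qed.

(** Serves maximality at the first vertex: an alternating path passing through [x] uses both colors
    there. *)
Lemma alt_walk_mid p q u s1 x w t : alt_walk p q u (s1 ++ x :: w :: t) ->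
  exists p' q' v, [/\ (p' = p /\ q' = q) \/ (p' = q /\ q' = p), R v q' = Some x
    & alt_walk p' q' x (w :: t)].
Proof.
elim: s1 p q u => [|v s1 IHs] p q u; first by case=> e h; exists q, p, u; split=> //; right.
case=> _ /IHs [p' [q' [v' [h1 h2 h3]]]]; exists p', q', v'; split=> //.
by case: h1; [right|left].
Qed.

(** At a vertex of the walk, each of the two colors is that of an edge of the walk or is missing;
    only [q] at the starting vertex escapes this rule. *)
Lemma walk_edge p q v s u c w : walk p q v s -> u \in v :: s ->
  c = p \/ c = q -> R u c = Some w ->
  (w \in v :: s /\ [set u; w] \in path_edges v s) \/ (u = v /\ c = q).
Proof.
elim: s p q v => [|w1 s IHs] p q v /=.
  move=> e; rewrite inE => /eqP-> [->|->]; first by rewrite e.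
  by right.
case=> r hs; rewrite inE -/(path_edges w1 s) => /orP[/eqP->|us] hc ru.
  case: hc => cE; last by right.
  by move: ru; rewrite cE r => -[<-]; left; rewrite !inE !eqxx orbT.
left; have [[ws es]|[uE cE]] := IHs _ _ _ hs us (proj1 (or_comm _ _) hc) ru.
  by rewrite inE ws orbT inE es orbT.
have [_ r'] := hR.1 _ _ _ r; move: ru; rewrite uE cE r' => -[<-].
by rewrite !inE eqxx setUC eqxx.
Qed.

Lemma walk_interior p q v s u : walk p q v s -> u \in s -> u != last v s ->
  R u p <> None /\ R u q <> None.
Proof.
elim: s p q v => [|w1 s IHs] p q v //= [r hs].
have [_ r'] := hR.1 _ _ _ r.
rewrite inE => /orP[/eqP->|us] ul; last by have [] := IHs _ _ _ hs us ul.
rewrite r'; split=> //; case: s hs ul {IHs} => [|w2 s] /=; first by rewrite eqxx.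
by case=> ->.
Qed.

(** The walk never meets itself: edges of the two colors at vertices before the end stay inside the
    path, and those that lead to the end have color [q]. So the neighbor along [p] is new, the same
    holds after adding it, and [#|T|] bounds the length. *)
Lemma walk_extend x n s p q : p != q -> #|T| <= n + size s -> uniq (x :: s) ->
  (forall u c w, u \in belast x s -> c = p \/ c = q -> R u c = Some w -> w \in x :: s) ->
  (forall u c, u \in belast x s -> c = p \/ c = q -> R u c = Some (last x s) -> c = q) ->
  (forall w, R (last x s) q = Some w -> w \in x :: s) ->
  exists s', walk p q (last x s) s' /\ uniq (x :: s ++ s').
Proof.
set v := last x s; elim: n s @v p q => [|n IHn] s v p q pq hn us hcl hen hq.
all: case r : (R v p) => [w|]; last by exists [::]; rewrite cats0.
all: have [a r'] := hR.1 _ _ _ r.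
all: have ws : w \notin x :: s.
1,3: apply/negP; rewrite lastI mem_rcons inE => /orP[/eqP e|wb];
  [by move: a; rewrite e adjN|by have := hen _ _ wb (or_introl erefl) r'; apply/eqP].
  have := max_card (mem (x :: s)); rewrite (card_uniqP us) /= => h.
  by have := leq_trans h hn; rewrite add0n ltnn.
have lw : last x (rcons s w) = w by rewrite last_rcons.
have vs : v \in x :: s by rewrite /v mem_last.
have split_mem u : u \in x :: s -> u = v \/ u \in belast x s.
  by rewrite lastI mem_rcons inE => /orP[/eqP|]; [left|right].
have mem_ext u : u \in x :: s -> u \in x :: rcons s w.
  by rewrite -rcons_cons [in X in _ -> X]mem_rcons [in X in _ -> X]inE orbC => ->.
have [s' [h1 h2]] : exists s', walk q p (last x (rcons s w)) s' /\ uniq (x :: rcons s w ++ s').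
  apply: (IHn (rcons s w) q p).
  - by rewrite eq_sym.
  - by rewrite size_rcons; lia.
  - by rewrite -rcons_cons rcons_uniq ws.
  - move=> u c w'; rewrite belast_rcons => /split_mem us' hc ru.
    have hc' : c = p \/ c = q by apply/or_comm.
    case: us' => [uv|ub]; last by apply/mem_ext/(hcl _ _ _ ub hc' ru).
    case: hc => cE; first by apply/mem_ext/hq; rewrite -uv -cE.
    by move: ru; rewrite uv cE r => -[<-]; rewrite -rcons_cons mem_rcons mem_head.
  - move=> u c; rewrite belast_rcons lw => /split_mem us' hc ru.
    have hc' : c = p \/ c = q by apply/or_comm.
    case: us' => [uv|ub]; first by move: ru; rewrite uv => ru; apply: (hR.2 _ _ _ _ ru r).
    by have := hcl _ _ _ ub hc' ru; rewrite (negbTE ws).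
  - by move=> w'; rewrite lw r' => -[<-]; apply: mem_ext.
exists (w :: s'); rewrite /= r; rewrite lw in h1; split=> //.
by move: h2; rewrite cat_rcons.
Qed.

Lemma walk_exists x a b : a != b -> R x a = None ->
  exists s, walk b a x s /\ uniq (x :: s).
Proof.
move=> ab xa; apply: (@walk_extend x #|T| [::] b a) => //.
- by rewrite eq_sym.
- by rewrite addn0.
- by move=> w; rewrite /= xa.
Qed.

(** * Exchanging the colors of a path *)

Definition swap a b c : 'I_D := if c == a then b else if c == b then a else c.

Lemma swapK a b : involutive (swap a b).
Proof.
move=> c; rewrite /swap; have [->|ca] := eqVneq c a.
  by have [->//|] := eqVneq b a; rewrite eqxx.
have [->|cb] := eqVneq c b; first by rewrite eqxx.
by rewrite (negbTE ca) (negbTE cb).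
Qed.

Lemma swapP a b c : (c = a /\ swap a b c = b) \/ (c = b /\ swap a b c = a) \/
  ([/\ c <> a, c <> b & swap a b c = c]).
Proof.
rewrite /swap; have [->|/eqP ca] := eqVneq c a; first by left.
by have [->|/eqP cb] := eqVneq c b; right; [left|right].
Qed.

(** Exchanging the colors in the rows of the vertices of [P] amounts to exchanging them on the edges
    of a maximal path, since no edge of color [a] or [b] leaves it. *)
Definition flip (P : seq T) a b v c : option T :=
  if v \in P then R v (swap a b c) else R v c.

(** The lists keep their lengths, so search costs after the exchange can be counted in the original
    system. *)
Lemma blank_flip P a b v : #|blank (flip P a b v)| = #|blank (R v)|.
Proof.
rewrite /flip; case: (v \in P) => //.
rewrite -(card_imset _ (inv_inj (swapK a b))) /=; congr #|pred_of_set _|.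
apply/setP => c; rewrite -[X in (X \in _) = _](swapK a b).
rewrite mem_imset; last exact: inv_inj (swapK a b).
by rewrite !inE swapK.
Qed.

Section Flip.
Variables (x : T) (a b : 'I_D) (s : seq T).
Hypotheses (ab : a != b) (xa : R x a = None) (hs : walk b a x s).
Let P := x :: s.
Let R1 := flip P a b.

Lemma walk_closed u c w : u \in P -> c = a \/ c = b -> R u c = Some w ->
  w \in P /\ [set u; w] \in path_edges x s.
Proof.
move=> uP hc r; have [//|[uE cE]] := walk_edge hs uP (proj1 (or_comm _ _) hc) r.
by rewrite uE cE xa in r.
Qed.

Lemma flip_other v c : c <> a -> c <> b -> R1 v c = R v c.
Proof.
move=> ca cb; rewrite /R1 /flip; case: (_ \in _) => //.
by have [[]|[[]|[_ _ ->]]] := swapP a b c.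
Qed.

Lemma valid_flip : valid adj R1.
Proof.
have [h1 h2] := hR; split=> [v c w|v c c' w]; rewrite /R1 /flip; last first.
  by case: (v \in P) => r r'; [apply: (inv_inj (swapK a b)); apply: h2 r r'|apply: h2 r r'].
case vP : (v \in P) => r; have [av r'] := h1 _ _ _ r; split=> //.
  case wP : (w \in P) => //.
  have [[cE sE]|[[cE sE]|[ca cb sE]]] := swapP a b c; rewrite sE in r r' *.
  - by have [] := walk_closed vP (or_intror erefl) r; rewrite wP.
  - by have [] := walk_closed vP (or_introl erefl) r; rewrite wP.
  - by [].
case wP : (w \in P) => //.
have [[cE sE]|[[cE sE]|[ca cb sE]]] := swapP a b c; last by rewrite sE.
- by rewrite cE in r'; have [] := walk_closed wP (or_introl erefl) r'; rewrite vP.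
- by rewrite cE in r'; have [] := walk_closed wP (or_intror erefl) r'; rewrite vP.
Qed.

Lemma flip_joined u v : joined R1 u v <-> joined R u v.
Proof.
rewrite /joined /R1 /flip; case: (u \in P) => //; split=> -[c r].
  by exists (swap a b c).
by exists (swap a b c); rewrite swapK.
Qed.

Lemma flip_start_a : R1 x a = R x b.
Proof. by rewrite /R1 /flip mem_head /swap eqxx. Qed.

Lemma flip_start_b : R1 x b = None.
Proof. by rewrite /R1 /flip mem_head /swap eqxx eq_sym (negbTE ab). Qed.

Lemma flip_keep u v c : [set u; v] \notin path_edges x s ->
  R1 u c = Some v <-> R u c = Some v.
Proof.
move=> ne; rewrite /R1 /flip; case uP : (u \in P) => //.
have no d : d = a \/ d = b -> R u d <> Some v.
  by move=> hd r; have [_] := walk_closed uP hd r; rewrite (negbTE ne).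
have [[-> ->]|[[-> ->]|[ca cb ->]]] := swapP a b c => //.
  by split=> /no[]; auto.
by split=> /no[]; auto.
Qed.

Lemma flip_blank v : v != x -> v != last x s -> blank (R1 v) = blank (R v).
Proof.
move=> vx vl; rewrite /R1 /flip; case vP : (v \in P) => //.
have [|] := walk_interior hs _ vl; first by move: vP; rewrite inE (negbTE vx).
move=> /eqP/negbTE hb /eqP/negbTE ha; apply/setP => c; rewrite !inE.
by have [[-> ->]|[[-> ->]|[ca cb ->]]] := swapP a b c; rewrite ?ha ?hb.
Qed.

(* A vertex that misses one of the two colors is off the path or an end. *)
Lemma flip_off v : v != x -> v != last x s -> R v b = None -> R1 v =1 R v.
Proof.
move=> vx vl vb c; rewrite /R1 /flip; case vP : (v \in P) => //.
have [|h _] := walk_interior hs _ vl; first by move: vP; rewrite inE (negbTE vx).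
by rewrite vb in h.
Qed.

End Flip.
End Kempe.

(** * Maximality of the path built from [x] *)

Section Maximal.
Variables (T : finType) (adj : rel T) (D : nat) (pi : coloring T D).
Hypotheses (adjC : symmetric adj) (adjN : irreflexive adj).
Hypothesis hp : partial_coloring adj pi.
Let R := system_of adj pi.
Let hR : valid adj R := valid_system_of adjC hp.

Lemma alternateS (p q : 'I_D) n : alternate p q n.+1 = Some p :: alternate q p n.
Proof.
rewrite /alternate /mkseq /= (iotaDl 1 0) -map_comp; congr cons.
by apply: eq_map => i /=; case: (odd i).
Qed.

Lemma alt_walkP p q v s : alt_walk R p q v s <->
  path adj v s /\ [seq pi e | e <- path_edges v s] = alternate p q (size s).
Proof.
elim: s p q v => [|w s IHs] p q v //=; rewrite alternateS -/(path_edges w s) IHs.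
split.
  case=> /(system_ofP _ _ _ hp)[a pe] [-> ->]; rewrite a pe; split=> //.
by case=> /andP[a h] [pe ->]; split=> //; apply/(system_ofP _ _ _ hp).
Qed.

Lemma walk_max_alt_path x a b s : R x a = None -> R x b <> None ->
  walk R b a x s -> uniq (x :: s) -> max_alt_path adj pi a b x s.
Proof.
move=> xa xb hs us; split.
  have /alt_walkP[h1 h2] := walk_alt hs.
  by split=> //; right.
move=> u r [hpath _ hcol] /infixP[s1 [s2 e]].
have [p [q [pq hr]]] : exists p q, ((p = b /\ q = a) \/ (p = a /\ q = b)) /\ alt_walk R p q u r.
  case: hcol => hcol.
    by exists a, b; split; [right|apply/alt_walkP].
  by exists b, a; split; [left|apply/alt_walkP].
case: s hs us e => [//|w s] hs us e.
have [_ xw] := hR.1 _ _ _ hs.1.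
have nin v : R v a <> Some x by move=> /hR.1[_]; rewrite xa.
(* If the longer path also starts at [x], it could only go on at the far end, where the next color
   is missing; otherwise it passes through [x], where [a] is missing. *)
case: s1 e => [|u1 s1] [eu er].
  subst u; have -> : r = w :: s; last by [].
  suff e2 : s2 = [::] by rewrite er e2 cats0.
  rewrite er in hr; apply: (@walk_maximal _ _ R b a x (w :: s)) => //.
  by case: pq hr => [[-> ->] //|[-> ->]] /= []; rewrite xa.
move: hr; rewrite er /= => /alt_walk_mid[p' [q' [v [h hv hw]]]].
have hh : (p' = b /\ q' = a) \/ (p' = a /\ q' = b).
  by case: pq h => [[-> ->]|[-> ->]] [[-> ->]|[-> ->]]; auto.
case: hh hv hw => [[-> ->] /nin //|[-> ->] _ /= []].
by rewrite xa.
Qed.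
End Maximal.

(** * The fan of a weak edge *)

Section Weak.
Variables (T : finType) (adj : rel T) (D : nat) (x y : T).
Hypotheses (adjC : symmetric adj) (adjN : irreflexive adj).
Hypotheses (hD : max_deg adj <= D) (hw : weak adj D x y).
Variable R : T -> 'I_D -> option T.
Hypotheses (hR : valid adj R) (xy : forall c, R x c <> Some y).

(** The default [y] concerns colors missing at [x], which never enter [seen]; likewise [set0] in
    [fan_blank]. *)
Definition fan_vertex (k : option 'I_D) : T := if k is Some c then odflt y (R x c) else y.
Definition fan_blank (k : option 'I_D) : {set 'I_D} :=
  match k with
  | None => blank (R y)
  | Some c => if R x c is Some z then blank (R z) else set0
  end.

Lemma deg_le v : deg adj v <= D.
Proof. by apply: leq_trans hD; rewrite /max_deg (bigD1 v) //= leq_maxl. Qed.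

(** The colors present at [v] inject into [A], as an edge has only one color. *)
Lemma card_blank v (A : {set T}) : (forall c w, R v c = Some w -> w \in A) ->
  D <= #|blank (R v)| + #|A|.
Proof.
move=> h; rewrite -[X in X <= _](card_ord D) -(cardC (mem (blank (R v)))) leq_add2l.
set f := fun c => odflt v (R v c).
rewrite -(@card_in_imset _ _ f).
  apply/subset_leq_card/subsetP => w /imsetP[c]; rewrite inE inE => rc ->.
  by rewrite /f; case r : (R v c) rc => [w'|] //= _; apply: h r.
move=> c c'; rewrite !inE /f => rc rc'.
case r : (R v c) rc => [w|//] _; case r' : (R v c') rc' => [w'|//] _ /= e.
by subst w'; apply: hR.2 r r'.
Qed.

(** Since [xy] is uncolored, [y] misses more than [D - deg adj y] colors. Every fan vertex of degree
    below [D] misses at least one color, and by weakness at most [D - deg adj y] fan vertices other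
    than [y] have degree [D]. *)
Lemma weak_enough (cs : seq 'I_D) : uniq cs ->
  {in cs, forall c, c \notin blank (R x)} ->
  size cs < \sum_(k <- None :: [seq Some c | c <- cs]) #|fan_blank k|.
Proof.
move=> us hcs; have [axy hwk] := hw.
have hy : D < #|blank (R y)| + deg adj y.
  have := @card_blank y (nbr adj y :\ x).
  have xy' : x \in nbr adj y by rewrite inE adjC.
  rewrite /deg (cardsD1 x (nbr adj y)) xy'.
  suff hh : forall c w, R y c = Some w -> w \in nbr adj y :\ x.
    by move=> /(_ hh); lia.
  move=> c w r; have [a r'] := hR.1 _ _ _ r; rewrite !inE a andbT.
  by apply/eqP => e; subst w; apply: xy r'.
pose full c := deg adj (fan_vertex (Some c)) == D.
have inz c : c \in cs -> R x c = Some (fan_vertex (Some c)).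
  by move=> /hcs; rewrite inE /=; case: (R x c).
have hfull : count full cs <= D - deg adj y.
  set S := [set w in nbr adj x | deg adj w == D] in hwk.
  (* The indicator in the definition of weakness pays exactly for [y] itself. *)
  have hS : #|S :\ y| <= D - deg adj y.
    have yS : (y \in S) = (deg adj y == D) by rewrite !inE axy.
    by rewrite -yS (cardsD1 y S) in hwk; lia.
  apply: leq_trans hS; rewrite -size_filter -(size_map (fun c => fan_vertex (Some c))).
  have um : uniq [seq fan_vertex (Some c) | c <- [seq c <- cs | full c]].
    rewrite map_inj_in_uniq ?filter_uniq // => c c'; rewrite !mem_filter.
    move=> /andP[_ /inz r] /andP[_ /inz r'] e.
    by rewrite e in r; apply: hR.2 r r'.
  rewrite -(card_uniqP um); apply/subset_leq_card/subsetP => z /mapP[c].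
  rewrite mem_filter => /andP[fc cc] ->; have [a _] := hR.1 _ _ _ (inz _ cc).
  have ny : fan_vertex (Some c) != y.
    by apply/eqP => e; have := inz _ cc; rewrite e => /xy.
  by rewrite in_setD1 ny !inE a.
rewrite big_cons big_map -[#|fan_blank None|]/(#|blank (R y)|).
have hs : size cs <= \sum_(c <- cs) #|fan_blank (Some c)| + count full cs.
  rewrite -sum1_size -sum1_count [X in _ + X]big_mkcond -big_split /=.
  rewrite big_seq [X in _ <= X]big_seq; apply: leq_sum => c cc.
  rewrite inz //; case: ifP => // fc; first by rewrite addn1.
  have lt : deg adj (fan_vertex (Some c)) < D.
    by rewrite ltn_neqAle deg_le andbT; exact: negbT fc.
  have : D <= #|blank (R (fan_vertex (Some c)))| + deg adj (fan_vertex (Some c)).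
    by apply: card_blank => c' w r; have [a _] := hR.1 _ _ _ r; rewrite inE.
  by rewrite addn0 /=; move: lt => /=; lia.
by have := deg_le y; lia.
Qed.
End Weak.

(** * Choosing the chain to rotate *)

Section Chain.
Variables (T : finType) (adj : rel T) (D : nat) (x y : T).
Hypotheses (adjC : symmetric adj) (adjN : irreflexive adj) (axy : adj x y).
Variable R : T -> 'I_D -> option T.
Hypotheses (hR : valid adj R) (xy : forall c, R x c <> Some y).
Local Notation mx := (blank (R x)).
Local Notation mz := (fan_blank x y R).
Local Notation zv := (fan_vertex x y R).
Variable F : fan D.
Hypothesis inv : fan_inv mx mz F.

Lemma fan_blank_None k c : c \in mz k -> R (zv k) c = None.
Proof.
case: k => [e|] /=; last by rewrite inE => /eqP.
by case: (R x e) => [z|]; rewrite inE // => /eqP.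
Qed.

Lemma fan_vertex_Some c : c \in colors (seen F) -> R x c = Some (zv (Some c)).
Proof.
by case: inv => _ nx _ _ _ /nx; rewrite inE /=; case: (R x c).
Qed.

Lemma fan_vertex_neq k : k \in vertices (seen F) -> zv k != x.
Proof.
rewrite inE => /orP[/eqP->|/mapP[c cs ->]]; apply/eqP => e.
  by move: axy; rewrite -e adjN.
have [a _] := hR.1 _ _ _ (fan_vertex_Some cs).
by move: a; rewrite e adjN.
Qed.

Lemma fan_vertex_inj : {in vertices (seen F) &, injective zv}.
Proof.
move=> k k'; rewrite !inE => /orP[/eqP->|/mapP[c cs ->]] /orP[/eqP->|/mapP[c' cs' ->]] //.
- by move=> e; have := fan_vertex_Some cs'; rewrite -e => /xy.
- by move=> e; have := fan_vertex_Some cs; rewrite e => /xy.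
move=> e; have := fan_vertex_Some cs; rewrite e => r.
by congr Some; apply: hR.2 r (fan_vertex_Some cs').
Qed.

Lemma fan_seen k c : (k, c) \in seen F ->
  [/\ c \in mz k, k \in take (hd F).+1 (vertices (seen F)) & c \in colors (seen F)].
Proof.
case: inv => _ _ _ _ e kc.
have : (k, c) \in scanned mz (take (hd F).+1 (vertices (seen F))).
  by rewrite -e mem_cat kc.
by rewrite mem_scanned => /andP[ks cm]; split=> //; apply: (map_f snd kc).
Qed.

(** The pairs of [scanned] are distinct, so a pair still to be scanned is not recorded: a color that
    is already seen was found at a vertex other than the current one. *)
Lemma fan_todo d t : todo F = d :: t ->
  [/\ d \in mz (current F), (current F, d) \notin seen F
    & current F \in take (hd F).+1 (vertices (seen F))].
Proof.
case: inv => un _ hs _ e te.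
have uv : uniq (take (hd F).+1 (vertices (seen F))).
  rewrite take_uniq //= map_inj_uniq ?un ?andbT; last by move=> a b [].
  by apply/mapP => -[].
have us : uniq (scanned mz (take (hd F).+1 (vertices (seen F)))).
  apply: (allpairs_uniq_dep (f := fun (k : option 'I_D) (c : 'I_D) => (k, c)) uv).
    by move=> k _; exact: enum_uniq.
  by move=> [k c] [k' c'] _ _ /= [-> ->].
have : (current F, d) \in scanned mz (take (hd F).+1 (vertices (seen F))).
  by rewrite -e te mem_cat /= mem_head orbT.
rewrite mem_scanned => /andP[ks cm]; split=> //.
apply/negP => kd; move: us; rewrite -e te cat_uniq /= => /and3P[_ /norP[]].
by rewrite kd.
Qed.

Lemma seen_inj k k' c : (k, c) \in seen F -> (k', c) \in seen F -> k = k'.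
Proof.
case: inv => un _ _ _ _; elim: (seen F) un => //= -[k0 c0] sn IH /andP[c0s us].
rewrite !inE => /orP[/eqP e|kc] /orP[/eqP e'|kc'].
- by case: e e' => -> _ [->].
- by case/negP: c0s; case: e => _ <-; exact: (map_f snd kc').
- by case/negP: c0s; case: e' => _ <-; exact: (map_f snd kc).
- exact: IH.
Qed.

Lemma take_vertices k n : k \in take n (vertices (seen F)) -> k \in vertices (seen F).
Proof. exact: mem_take. Qed.

(** The relabeling [sigma] of the colors at [x] lets one statement serve both cases: the identity
    without a path, [b] to [a] after an exchange. *)
Lemma chain_springs R1 (sigma : 'I_D -> 'I_D) k l d : chain (seen F) k l ->
  R1 (zv k) d = None ->
  (forall c, c \in l -> R1 x (sigma c) = Some (zv (Some c))) ->
  (forall k' c, (k', c) \in seen F -> c \in l -> R1 (zv k') (sigma c) = None) ->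
  springs R1 x y d (map sigma l).
Proof.
elim: l k d => [|c l IHl] k d /=; first by move=> ->.
move=> [-> [k' kc ch]] rd h1 h2; exists (zv (Some c)); split=> //.
  by apply: h1; rewrite mem_head.
apply: IHl ch _ _ _.
- by apply: h2; rewrite ?mem_head.
- by move=> e el; apply: h1; rewrite inE el orbT.
- by move=> k1 e ke el; apply: h2 => //; rewrite inE el orbT.
Qed.

Lemma fan_colors_x c : c \in colors (seen F) -> R x c <> None.
Proof. by move/fan_vertex_Some=> ->. Qed.

Lemma chain_colors k l c : chain (seen F) k l -> c \in l -> c \in colors (seen F).
Proof.
elim: l k => //= e l IHl k [_ [k' kc ch]]; rewrite inE => /orP[/eqP->|].
  exact: (map_f snd kc).
exact: IHl ch.
Qed.

Lemma rotate_free d t : todo F = d :: t -> status mx F = Some false ->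
  exists l, [/\ chain (seen F) (current F) l, rotatable adj R x y d l
    & chain_cost mz l <= 3 * D + 1 + D].
Proof.
move=> te; rewrite /status te; case: ifP => [dx _|_]; last by case: ifP.
have [dm _ ck] := fan_todo te; have [un nx hs [sp ut] e] := inv.
have [||l [ch ul ls]] := @chain_exists D (rev (seen F)) (current F) _ sp.
- by rewrite /colors map_rev rev_uniq.
- by rewrite mem_vertices_rev (take_vertices ck).
have {ch} ch : chain (seen F) (current F) l.
  by apply: chain_sub ch => p; rewrite mem_rev.
exists l; split=> //; last exact: chain_cost_le inv ck ch ul.
split=> //.
  by split=> //; apply/eqP; rewrite inE in dx.
rewrite -[l]map_id; apply: (chain_springs ch).
- exact: fan_blank_None.
- by move=> c cl; apply: fan_vertex_Some; apply: chain_colors ch cl.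
- by move=> k' c /fan_seen[cm _ _] _; apply: fan_blank_None.
Qed.

Section Flipped.
Variables (a b : 'I_D) (t : seq 'I_D) (s : seq T) (k' : option 'I_D).
Hypotheses (xa : R x a = None) (te : todo F = b :: t).
Hypotheses (st : status mx F = Some true) (kb : (k', b) \in seen F).
Hypothesis hs : walk R b a x s.
Let R1 := flip R (x :: s) a b.
Let sigma c := if c == b then a else c.

Lemma conflict_neq : a != b.
Proof.
have [_ _ /fan_colors_x rb] := fan_seen kb.
by apply/eqP => e; rewrite -e xa in rb.
Qed.

(** Chain colors are present at [x], hence differ from [a], and the exchange leaves all of them but
    [b] alone. If [b] occurs, the last hypothesis puts [k'] on the path, and its missing color [b]
    becomes a missing [a]. *)
Lemma rotatable_flip k l : chain (seen F) k l -> uniq l ->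
  k \in vertices (seen F) -> R1 (zv k) b = None ->
  (b \in l -> last x s = zv k') ->
  rotatable adj R1 x y b (map sigma l).
Proof.
move=> ch ul kv rb hb; have ab := conflict_neq.
have la c : c \in l -> c <> a.
  by move=> /(chain_colors ch)/fan_colors_x rc e; apply: rc; rewrite e.
split.
- exact: valid_flip.
- by split=> //; apply: flip_start_b.
- move=> c; rewrite /R1 /flip; case: ifP => _; exact: xy.
- rewrite map_inj_in_uniq // => c e cl el; rewrite /sigma.
  have [->|cb] := eqVneq c b; have [->|eb] := eqVneq e b => //.
    by move=> ae; case: (la _ el).
  by move=> ae; case: (la _ cl).
- apply: (chain_springs ch rb) => [c cl|k1 c kc cl].
    have rc := fan_vertex_Some (chain_colors ch cl); rewrite /sigma.
    have [e|/eqP cb] := eqVneq c b; first by rewrite /R1 flip_start_a -e rc.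
    by rewrite /R1 flip_other //; apply: la.
  have [cm _ _] := fan_seen kc; have rc := fan_blank_None cm; rewrite /sigma.
  have [e|/eqP cb] := eqVneq c b; last by rewrite /R1 flip_other //; apply: la.
  subst c; rewrite (seen_inj kc kb) -(hb cl).
  rewrite /R1 /flip mem_last /swap eqxx (hb cl).
  by rewrite -(seen_inj kc kb).
Qed.

Lemma rotate_conflict :
  exists k l, [/\ k = (if last x s == zv k' then current F else k'),
    chain (seen F) k l, rotatable adj R1 x y b (map sigma l)
    & chain_cost mz l <= 3 * D + 1 + D].
Proof.
have [dm dn ck] := fan_todo te; have [un nx _ [sp ut] e] := inv.
have [bm k's bs] := fan_seen kb; have ab := conflict_neq.
have un' : uniq (colors (rev (seen F))) by rewrite /colors map_rev rev_uniq.
have [lk|lk] := eqVneq (last x s) (zv k').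
  have [|l [ch ul ls]] := chain_exists un' sp (k := current F).
    by rewrite mem_vertices_rev (take_vertices ck).
  have {ch} ch : chain (seen F) (current F) l.
    by apply: chain_sub ch => p; rewrite mem_rev.
  exists (current F), l; split=> //; last exact: chain_cost_le inv ck ch ul.
  (* The path ends at [k'], which is not the current vertex, so the latter keeps [b] missing. *)
  apply: rotatable_flip ch ul (take_vertices ck) _ _ => //.
  rewrite /R1 (flip_off hR hs) //.
  - exact: fan_blank_None.
  - exact: fan_vertex_neq (take_vertices ck).
  - apply/eqP; rewrite lk => /fan_vertex_inj h.
    by move: dn; rewrite h ?kb ?take_vertices // (take_vertices ck, take_vertices k's).
  - exact: fan_blank_None.
have kb' : (k', b) \in rev (seen F) by rewrite mem_rev.
have [l [ch ul ls bl]] := chain_exists_before un' sp kb'.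
have {ch} ch : chain (seen F) k' l.
  by apply: chain_sub ch => p; rewrite mem_rev.
exists k', l; split=> //; last exact: chain_cost_le inv k's ch ul.
apply: rotatable_flip ch ul (take_vertices k's) _ _.
  rewrite /R1 (flip_off hR hs) //.
  - exact: fan_blank_None.
  - exact: fan_vertex_neq (take_vertices k's).
  - by rewrite eq_sym.
  - exact: fan_blank_None.
by rewrite (negbTE bl).
Qed.
End Flipped.
End Chain.

(** * The fan search as a program *)

Notation "p ;; q" := (Seq p q) (at level 61, right associativity).

(* Registers: 5 holds [M_x]; 7 the queue; 9 and 10 its head and tail; 11 and 12
   the current fan vertex (color of its edge to [x], or 0 for [y]) and its
   array; 13 the color under scrutiny; 14 the outcome (1: missing at [x] too,
   2: missing at another fan vertex).  The entry of a color in the array at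
   [Reg 4] is 0 as long as the color is not seen, and otherwise the successor of
   the fan vertex where it was seen. *)
Definition fan_init : cmd :=
  Assign 5 (Read (Add (Reg 1) (Cst 1))) ;;
  Assign 7 (Add (Add (Reg 4) (Reg 0)) (Cst 1)) ;;
  Assign 8 (Cst 1) ;;
  While (Leq (Reg 8) (Reg 0))
    (Write (Add (Reg 4) (Reg 8)) (Cst 0) ;;
     Assign 8 (Add (Reg 8) (Cst 1))) ;;
  Assign 9 (Cst 0) ;;
  Assign 10 (Cst 0) ;;
  Assign 11 (Cst 0) ;;
  Assign 12 (Read (Add (Reg 2) (Cst 1))) ;;
  Assign 13 (Read (Reg 12)) ;;
  Assign 14 (Cst 0).

Definition fan_body : cmd :=
  If (Eqn (Reg 13) (Cst 0))
    (Assign 11 (Read (Add (Reg 7) (Reg 9))) ;;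
     Assign 9 (Add (Reg 9) (Cst 1)) ;;
     Assign 12 (Read (Add (Read (Add (Reg 5) (Reg 11))) (Cst 1))) ;;
     Assign 13 (Read (Reg 12)))
    (If (Leq (Read (Add (Reg 5) (Reg 13))) (Reg 0))
       (Assign 14 (Cst 1))
       (If (Leq (Cst 1) (Read (Add (Reg 4) (Reg 13))))
          (Assign 14 (Cst 2))
          (Write (Add (Reg 4) (Reg 13)) (Add (Reg 11) (Cst 1)) ;;
           Write (Add (Reg 7) (Reg 10)) (Reg 13) ;;
           Assign 10 (Add (Reg 10) (Cst 1)) ;;
           Assign 13 (Read (Add (Reg 12) (Reg 13)))))).

Definition search : cmd := fan_init ;; While (Eqn (Reg 14) (Cst 0)) fan_body.

Definition index_code D (k : option 'I_D) : nat := if k is Some c then c.+1 else 0.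

Section Search.
Variables (T : finType) (adj : rel T) (D : nat) (L : layout T) (free : nat).
Hypothesis wf : wf_layout adj D L free.
Variables (x y : T) (R : T -> 'I_D -> option T).
Local Notation mx := (blank (R x)).
Local Notation mz := (fan_blank x y R).
Local Notation zv := (fan_vertex x y R).
Hypothesis enough : forall cs : seq 'I_D, uniq cs ->
  {in cs, forall c, c \notin mx} ->
  size cs < \sum_(k <- None :: [seq Some c | c <- cs]) #|mz k|.
Variable s0 : state.
Hypotheses (hr : rep L R (heap s0)).
Hypotheses (e0 : regs s0 0 = D) (e1 : regs s0 1 = vaddr L x)
  (e2 : regs s0 2 = vaddr L y) (e4 : regs s0 4 = free).

Record fan_state (F : fan D) (s : state) : Prop := FanState {
  fs_frame : frame 5 s0 s;
  fs_row : regs s 5 = marr L x;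
  fs_queue : regs s 7 = free + D + 1;
  fs_head : regs s 9 = hd F;
  fs_tail : regs s 10 = size (seen F);
  fs_cur : regs s 11 = index_code (current F);
  fs_arr : regs s 12 = marr L (zv (current F));
  fs_color : regs s 13 = ohead_code (todo F);
  fs_todo : exists k, todo F = later (mz (current F)) k;
  fs_heap : forall a, a < free -> heap s a = heap s0 a;
  fs_seen : forall k c, (k, c) \in seen F -> heap s (free + c.+1) = (index_code k).+1;
  fs_unseen : forall c : 'I_D, c \notin colors (seen F) -> heap s (free + c.+1) = 0;
  fs_list : forall i, i < size (seen F) ->
    heap s (free + D + 1 + i) = index_code (nth None (vertices (seen F)) i.+1)
}.

Lemma rep_marr (R' : T -> 'I_D -> option T) h v : rep L R' h -> h (vaddr L v + 1) = marr L v.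
Proof. by move=> /(_ v)[_ e _]; rewrite addn1. Qed.

Lemma row_low v i : i <= D -> marr L v + i < free.
Proof. by move=> iD; have /andP[] := row_range wf v iD. Qed.

Lemma vaddr_low v : vaddr L v + 1 < free.
Proof.
rewrite addn1; have : (vaddr L v).+1 \in cells D L v by rewrite /cells /= inE mem_head orbT.
by move/(cells_range wf)/andP => [].
Qed.

Lemma runs_fan_init : runs fan_init s0 (60 * D + 100) (fun s =>
  fan_state (fan_start mz) s /\ regs s 14 = 0).
Proof.
pose I n s := [/\ frame 5 s0 s, regs s 5 = marr L x /\ regs s 7 = free + D + 1,
  forall a, a < free -> heap s a = heap s0 a
  & exists i, [/\ regs s 8 = i.+1, n = D - i, i <= D
    & forall j, 0 < j -> j <= i -> heap s (free + j) = 0]].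
step; step; step; rewrite e0 e1 e4 (rep_marr _ hr).
apply: (@runs_seq _ _ _ (D * 14 + 6) 39 _ (I 0)).
- apply: (@runs_weaken _ _ (D * (10 + 4) + 4) _ (I 0)); [|by lia|done].
  apply: (@runs_while_iter _ _ 10 I).
  + move=> n s [f h5 hh [i [h8 hn le hz]]] /=; rewrite h8 (f 0) // e0 => hi.
    split=> //; exists i; split=> //; lia.
  + move=> n s [f [h5 h7] hh [i [h8 hn le hz]]] /=; rewrite h8 (f 0) // e0 => hi.
    split; first by lia.
    step; apply: runs_assign => //; rsimp; rewrite (f 4) // e4 h8.
    split=> //.
    * by frame_tac; apply: f.
    * by move=> a fa; rsimp; rewrite upd_neq ?hh //; lia.
    * exists i.+1; split; rsimp; try by lia.
      move=> j j0 ji; rsimp; rewrite updE; case: eqP => // ne; apply: hz => //; lia.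
  + split=> //; first by frame_tac.
    by exists 0; split=> //; rewrite ?subn0 // => j; lia.
- move=> s [f [h5 h7] hh [i [h8 hn le hz]]].
  step; step; step; step; step; apply: runs_assign => //; rsimp.
  rewrite (f 2) // e2 hh ?vaddr_low // (rep_marr _ hr).
  split=> //; split; rsimp => //.
  + by frame_tac; apply: f.
  + rewrite hh; last by have := row_low y (leq0n D); rewrite addn0.
    by have [_ _ [_ -> _]] := hr y; rewrite next_codeE later0.
  + by exists 0; rewrite later0.
  + by move=> c _; apply: hz => //; have := ltn_ord c; lia.
- by budget.
Qed.

Lemma current_rcons (F : fan D) k c t : hd F <= size (seen F) ->
  current (Fan (rcons (seen F) (k, c)) (hd F) t) = current F.
Proof.
move=> hs; rewrite /current; cbn [seen hd].
by rewrite vertices_rcons nth_rcons size_vertices ltnS hs.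
Qed.

Lemma fan_color_Some F c : fan_inv mx mz F -> c \in colors (seen F) ->
  R x c = Some (zv (Some c)).
Proof. by case=> _ nx _ _ _ /nx; rewrite inE /=; case: (R x c). Qed.

Lemma fan_blank_vertex k c : c \in mz k -> mz k = blank (R (zv k)).
Proof. by case: k => [e|] //=; case: (R x e) => [z|] //; rewrite inE. Qed.

Lemma fan_state_outcome F s v : fan_state F s ->
  fan_state F (State (upd (regs s) 14 v) (heap s)).
Proof.
case=> f r5 r7 r9 r10 r11 r12 r13 td hh hsn hun hl; split=> //.
by frame_tac; apply: f.
Qed.

Lemma ohead_cons (c : 'I_D) t : ohead_code (c :: t) = c.+1.
Proof. by []. Qed.

Lemma runs_fan_body F s : fan_inv mx mz F -> fan_state F s -> regs s 14 = 0 ->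
  runs fan_body s 60 (fun s' =>
    if status mx F is Some b then fan_state F s' /\ regs s' 14 = b.+1
    else fan_state (fan_step mx mz F) s' /\ regs s' 14 = 0).
Proof.
move=> inv fs e14; have hstep := fan_step_inv enough inv.
have [f r5 r7 r9 r10 r11 r12 r13 [kk td] hh hsn hun hl] := fs.
have r0 : regs s 0 = D by rewrite f.
have r4 : regs s 4 = free by rewrite f.
apply: runs_if; rsimp; rewrite r13.
case te : (todo F) td => [|c t] td.
  have st : status mx F = None by rewrite /status te.
  have [[_ _ hs' _ _] _] := hstep st; rewrite st /=.
  rewrite /fan_step te in hs' *; cbn [hd seen] in hs'.
  set k1 := nth _ _ _.
  (* The invariant of the next state keeps the new head inside the queue, so a genuine color is read
     there. *)
  have [c k1E cs] : exists2 c, k1 = Some c & c \in colors (seen F).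
    have : k1 \in [seq Some c | c <- colors (seen F)].
      by apply: mem_nth; rewrite !size_map.
    by case/mapP => c cs ->; exists c.
  have rc := fan_color_Some inv cs.
  have cD := ltn_ord c.
  step; step; step; apply: runs_assign => //; rsimp.
  rewrite r5 r7 r9 hl // -/k1 k1E [index_code _]/=.
  rewrite (hh (marr L x + _)) ?row_low // (rep_Some hr rc).
  rewrite (hh (vaddr L _ + 1)) ?vaddr_low // (rep_marr _ hr).
  split=> //; split; rsimp => //.
  - by frame_tac; apply: f.
  - by rewrite addn1.
  - by rewrite /current; cbn [seen hd]; rewrite -/k1 k1E.
  - by rewrite /current; cbn [seen hd]; rewrite -/k1 k1E.
  - rewrite hh; last by have := row_low (zv (Some c)) (leq0n D); rewrite addn0.
    have [_ _ [_ -> _]] := hr (zv (Some c)); rewrite next_codeE later0 /=.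
    by rewrite rc.
  - by exists 0; rewrite later0 /current; cbn [seen hd todo]; rewrite -/k1 k1E.
have cD := ltn_ord c.
rewrite ohead_cons; apply: runs_if; rsimp.
rewrite r5 r13 te ohead_cons r0 hh ?row_low //.
rewrite /status /fan_step te.
case rc : (R x c) => [z|]; last first.
  rewrite (rep_None hr rc) inE rc eqxx; apply: runs_assign => //.
  by split; [apply: fan_state_outcome fs|rsimp].
rewrite (rep_Some hr rc) leqNgt.
have /andP[-> _] := vaddr_range wf z.
rewrite inE rc /=; apply: runs_if; rsimp; rewrite r4 r13 te ohead_cons.
have [cs|cs] := boolP (c \in colors (seen F)).
  have [[k c'] kc /= ce] := mapP cs; subst c'.
  rewrite (hsn _ _ kc) /=; apply: runs_assign => //.
  by split; [apply: fan_state_outcome fs|rsimp].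
rewrite (hun _ cs) /=.
have [cm tE] := later_cons (esym td).
have bE := fan_blank_vertex cm.
have hs : hd F <= size (seen F) by case: inv.
have sD : size (seen F) <= D by case: inv => /size_colors.
step; step; step; apply: runs_assign => //; rsimp.
rewrite r4 r7 r10 r11 r12 r13 te ohead_cons.
split=> //; split; rsimp => //.
- by frame_tac; apply: f.
- by rewrite size_rcons addn1.
- by rewrite current_rcons.
- by rewrite current_rcons.
- rewrite !upd_neq; try by have := row_low (zv (current F)) cD; lia.
  rewrite hh ?row_low //.
  have [_ _ [_ _ h3]] := hr (zv (current F)).
  rewrite h3; last by apply/eqP; rewrite -in_blank -bE.
  by rewrite next_codeE -bE -tE.
- by exists c.+1; rewrite current_rcons.
- by move=> a fa; rewrite !upd_neq ?hh //; lia.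
- move=> k e; rewrite mem_rcons inE => /orP[/eqP[-> ->]|ke].
    by rewrite upd_neq ?upd_eq ?addn1 //; lia.
  have eD := ltn_ord e; rewrite upd_neq; last by lia.
  rewrite upd_neq ?(hsn _ _ ke) //; rewrite eqn_add2l code_eq.
  by apply: contraNneq cs => <-; exact: (map_f snd ke).
- move=> e; rewrite /colors map_rcons mem_rcons inE negb_or => /andP[ec es].
  have eD := ltn_ord e; rewrite upd_neq; last by lia.
  by rewrite upd_neq ?(hun _ es) // eqn_add2l code_eq.
- move=> i; rewrite size_rcons ltnS leq_eqVlt => /orP[/eqP->|lt].
    rewrite upd_eq vertices_rcons nth_rcons size_vertices ltnn eqxx //.
  rewrite upd_neq ?upd_neq; try by lia.
  by rewrite hl // vertices_rcons nth_rcons size_vertices ltnS lt.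
Qed.

Lemma runs_search : runs search s0 (300 * D + 300) (fun s =>
  [/\ fan_state (fan_end mx mz) s, fan_inv mx mz (fan_end mx mz)
    & exists b, status mx (fan_end mx mz) = Some b /\ regs s 14 = b.+1]).
Proof.
(* Each step raises the measure [size (seen F) + hd F] by one, so it numbers the iterate. It is at
   most [D + D], so while [n] plus the measure is at least [D + D + 2] an iteration is left. *)
pose I n s := exists F, [/\ fan_state F s, fan_inv mx mz F,
  F = iter (size (seen F) + hd F) (fan_step mx mz) (fan_start mz)
  & (exists b, status mx F = Some b /\ regs s 14 = b.+1) \/
    (regs s 14 = 0 /\ D + D + 2 <= n + (size (seen F) + hd F))].
have bound F : fan_inv mx mz F -> size (seen F) + hd F <= D + D.
  by case=> /size_colors h _ h' _ _; lia.
apply: (@runs_seq _ _ _ _ ((D + D + 2) * (60 + 4) + 4) _ _ _ runs_fan_init);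
  last by lia.
move=> s [fs e14].
have I0 : I (D + D + 2) s.
  exists (fan_start mz); split=> //; first exact: fan_inv_start.
  by right; split=> //=; lia.
apply: (@runs_while_iter (Eqn (Reg 14) (Cst 0)) _ 60 I _ _ _ _ _ I0).
  move=> n s' [F [fs' inv FE [[b [st e]]|[e _]]]] /=; last by rewrite e.
  move=> _; have FE' : F = fan_end mx mz.
    rewrite {1}FE; apply: fan_iter_end; first by rewrite -FE st.
    by have := bound _ inv; lia.
  by rewrite -FE'; split=> //; exists b.
move=> n s' [F [fs' inv FE [[b [st e]]|[e le]]]] /=; first by rewrite e.
move=> _; split; first by have := bound _ inv; lia.
apply: runs_weaken (runs_fan_body inv fs' e) (leqnn _) _ => s1.
case st : (status mx F) => [b|] [fs1 e1'].
  by exists F; split=> //; left; exists b.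
have [inv1 sz] := fan_step_inv enough inv st.
exists (fan_step mx mz F); split=> //; first by rewrite sz iterS -FE.
by right; split=> //; rewrite sz; lia.
Qed.

End Search.

(* Register 17 holds the current vertex of the path, reached by the color in
   register 19; register 18 holds the other color and 8 its entry at that
   vertex. *)
Definition flip_body : cmd :=
  Assign 20 (Read (Add (Reg 17) (Cst 1))) ;;
  Write (Add (Reg 20) (Reg 18)) (Read (Add (Reg 20) (Reg 19))) ;;
  Write (Add (Reg 20) (Reg 19)) (Reg 8) ;;
  Assign 17 (Reg 8) ;;
  Assign 8 (Reg 18) ;;
  Assign 18 (Reg 19) ;;
  Assign 19 (Reg 8) ;;
  Assign 8 (Read (Add (Read (Add (Reg 17) (Cst 1))) (Reg 18))).

Definition flip_loop : cmd := While (Leq (Add (Reg 0) (Cst 1)) (Reg 8)) flip_body.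

(** At [x] the color [a] takes over the edge of color [b], but the entry of [b] is left stale,
    without a return to the list of missing colors, until the rotation gives [b] to a fan edge. *)
Definition flip_path : cmd :=
  Assign 17 (Read (Add (Reg 5) (Reg 13))) ;;
  Assign 20 (Reg 5) ;;
  Assign 21 (Reg 15) ;;
  Assign 22 (Reg 17) ;;
  delete ;;
  Assign 18 (Reg 15) ;;
  Assign 19 (Reg 13) ;;
  Assign 8 (Read (Add (Read (Add (Reg 17) (Cst 1))) (Reg 18))) ;;
  flip_loop ;;
  Assign 20 (Read (Add (Reg 17) (Cst 1))) ;;
  Assign 21 (Reg 18) ;;
  Assign 22 (Read (Add (Reg 20) (Reg 19))) ;;
  delete ;;
  Assign 20 (Read (Add (Reg 17) (Cst 1))) ;;
  Assign 21 (Reg 19) ;;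
  insert.

(* Register 16 holds the color whose fan edge has been recolored with the color
   in register 15 by the exchange along the path. *)
Definition rotate_body : cmd :=
  If (Eqn (Reg 11) (Reg 16)) (Assign 11 (Reg 15)) Skip ;;
  Assign 17 (Read (Add (Reg 5) (Reg 11))) ;;
  Assign 18 (Read (Add (Reg 17) (Cst 1))) ;;
  Assign 20 (Reg 18) ;;
  Assign 21 (Reg 13) ;;
  Assign 22 (Reg 1) ;;
  delete ;;
  Assign 20 (Reg 18) ;;
  Assign 21 (Reg 11) ;;
  insert ;;
  Write (Add (Reg 5) (Reg 13)) (Reg 17) ;;
  Assign 13 (Reg 11) ;;
  Assign 11 (Defs.Sub (Read (Add (Reg 4) (Reg 11))) (Cst 1)).

Definition rotate_loop : cmd := While (Leq (Cst 1) (Reg 11)) rotate_body.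

Definition rotate_chain : cmd :=
  rotate_loop ;;
  Assign 20 (Read (Add (Reg 2) (Cst 1))) ;;
  Assign 21 (Reg 13) ;;
  Assign 22 (Reg 1) ;;
  delete ;;
  Write (Add (Reg 5) (Reg 13)) (Reg 2).

(** * Correctness and running time of the exchange and of the rotation *)

Section Loops.
Variables (T : finType) (adj : rel T) (D : nat) (L : layout T) (free : nat).
Hypothesis wf : wf_layout adj D L free.
Hypotheses (adjC : symmetric adj) (adjN : irreflexive adj).
Implicit Types (R : T -> 'I_D -> option T).

Lemma upR_far R v c o u : u != v -> upR R v c o u =1 R u.
Proof. by move=> uv d; rewrite upRE (negbTE uv). Qed.

Section Flip.
Variable R : T -> 'I_D -> option T.
Hypothesis hR : valid adj R.

Definition frame_flip (s s' : state) : Prop :=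
  forall r, r < 17 -> r != 8 -> regs s' r = regs s r.

Lemma swapC (a b : 'I_D) : swap a b =1 swap b a.
Proof.
move=> c; rewrite /swap; have [ca|ca] := eqVneq c a; have [cb|cb] := eqVneq c b => //.
by rewrite -ca -cb.
Qed.

(** [Rc] is the system in memory: it agrees with [R] from the current vertex on, while the vertices
    behind may already have new rows. Both colors are present at each vertex treated by the loop, so
    two writes per vertex suffice. *)
Lemma runs_flip_loop (p q : 'I_D) v t Rc s : p != q -> walk R p q v t -> uniq (v :: t) ->
  R v q <> None -> {in v :: t, forall u, Rc u =1 R u} -> rep L Rc (heap s) ->
  [/\ regs s 0 = D, regs s 17 = vaddr L v, regs s 18 = p.+1, regs s 19 = q.+1
    & regs s 8 = heap s (marr L v + p.+1)] ->
  runs flip_loop s (70 * size t + 50) (fun s' =>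
    [/\ frame_flip s s', forall a, free <= a -> heap s' a = heap s a,
      rep L (fun u c => if u \in belast v t then R u (swap p q c) else Rc u c) (heap s')
    & exists p' q' : 'I_D, [/\ regs s' 17 = vaddr L (last v t), regs s' 18 = p'.+1,
        regs s' 19 = q'.+1, R (last v t) p' = None /\ R (last v t) q' <> None
      & (p' = p /\ q' = q) \/ (p' = q /\ q' = p)]]).
Proof.
elim: t p q v Rc s => [|w t IHt] p q v Rc s pq hw us vq hRc hr [r0 r17 r18 r19 r8].
  apply: (@runs_while _ _ _ 0 _ (fun=> False)) => //=; rewrite r0 r8 addn1.
  - move=> _; split=> //; exists p, q; split=> //; by [|left].
  - rewrite ltnNge (rep_None hr (c := p)) //.
    by rewrite hRc ?mem_head.
have [vw hw'] := hw; have [avw wv] := hR.1 _ _ _ vw.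
have vwc : Rc v p = Some w by rewrite hRc ?mem_head.
apply: (@runs_while _ _ _ 60 _ (fun s1 => [/\ frame_flip s s1,
    forall a, free <= a -> heap s1 a = heap s a,
    rep L (upr Rc v (fun c => R v (swap p q c))) (heap s1) &
   [/\ regs s1 17 = vaddr L w, regs s1 18 = q.+1, regs s1 19 = p.+1
    & regs s1 8 = heap s1 (marr L w + q.+1)]])) => /=.
- by lia.
- by rewrite r0 r8 (rep_Some hr vwc) addn1; have /andP[->] := vaddr_range wf w.
- move=> _; case vqE : (R v q) vq => [z|//] _.
  have vqc : Rc v q = Some z by rewrite hRc ?mem_head.
  do 7 step; apply: runs_assign => //; rsimp.
  rewrite r17 r18 r19 (rep_marr v hr) r8 (rep_Some hr vwc) (rep_Some hr vqc).
  have hr1 := rep_set wf z hr vwc.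
  have hr2 := rep_set wf w hr1 (v := v) (c := q) (w := z).
  rewrite upRE eqxx /= eq_sym (negbTE pq) vqc in hr2; have {hr2} hr2 := hr2 erefl.
  split.
  + by move=> r lt ne; rsimp; rewrite ?upd_neq //; lia.
  + move=> a fa; rsimp.
    have := row_low wf v (ltn_ord p); have := row_low wf v (ltn_ord q).
    by move=> h1 h2; rewrite !upd_neq //; lia.
  + rsimp; apply: rep_ext hr2 => u c; rewrite !upRE /upr.
    have [->|//] := eqVneq u v; rewrite /swap /=.
    have [->|cq] := eqVneq c q; first by rewrite eq_sym (negbTE pq) vw.
    have [_|cp] := eqVneq c p; first by rewrite vqE.
    by rewrite hRc ?mem_head.
  + by rsimp; rewrite (rep_marr w hr2).
move=> _ s1 [f1 h1 hr1 [e17 e18 e19 e8]].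
have /andP[vt uw] : (v \notin w :: t) && uniq (w :: t) by [].
have off u : u \in w :: t -> u != v by move=> ut; apply: contraNneq vt => <-.
apply: runs_weaken (IHt q p w (upr Rc v (fun c => R v (swap p q c))) s1 _ hw' uw _ _ hr1 _) _ _.
- by rewrite eq_sym.
- by rewrite wv.
- by move=> u ut c; rewrite /upr (negbTE (off _ ut)) hRc // inE ut orbT.
- by rewrite f1.
- by budget.
move=> s2 [f2 h2 hr2 [p' [q' [e17' e18' e19' hl hpq]]]]; split.
- by move=> r lt ne; rewrite f2 // f1.
- by move=> a fa; rewrite h2 // h1.
- apply: rep_ext hr2 => u c; rewrite inE; have [ub|ub] := boolP (u \in belast w t).
    by rewrite orbT; congr (R u); apply: swapC.
  by rewrite orbF /upr; have [->|//] := eqVneq u v.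
- by exists p', q'; split=> //; case: hpq; [right|left].
Qed.

Section FlipPath.
Variables (x : T) (a b : 'I_D) (t : seq T).
Hypotheses (ab : a != b) (xa : R x a = None) (xb : R x b <> None).
Hypotheses (hw : walk R b a x t) (us : uniq (x :: t)).

Lemma runs_flip_path s : rep L R (heap s) ->
  [/\ regs s 0 = D, regs s 5 = marr L x, regs s 13 = b.+1 & regs s 15 = a.+1] ->
  exists z, runs flip_path s (90 * D + 70 * size t + 500) (fun s' =>
    [/\ frame_flip s s', forall a, free <= a -> heap s' a = heap s a,
      rep L (upR (flip R (x :: t) a b) x b (Some z)) (heap s')
      & regs s' 17 = vaddr L (last x t)]).
Proof.
move=> hr [r0 r5 r13 r15].
case: t hw us => [//|z t'] [xz hw'] us'; exists z.
have bD (A : {set 'I_D}) : #|A| <= D by rewrite -[X in _ <= X](card_ord D) max_card.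
step; step; step; step; rewrite r5 r13 r15 (rep_Some hr xz).
apply: (@runs_seq _ _ _ _ (60 * D + 70 * size t' + 380) _ _ _
  (@runs_delete _ _ _ _ _ wf R _ x a z _ xa _ _ _)); rsimp => //; last first.
  by move: (bD (blank (R x))); budget.
move=> s1 [f1 hr1 h1].
have [axz zx] := hR.1 _ _ _ xz.
have zNx : z != x by apply/eqP => e; move: axz; rewrite e adjN.
step; step; step.
have e17 : regs s1 17 = vaddr L z by rewrite f1.
have e13 : regs s1 13 = b.+1 by rewrite f1.
have e15 : regs s1 15 = a.+1 by rewrite f1.
rewrite e17 e13 e15 (rep_marr z hr1).
have /andP[xt ut] : (x \notin z :: t') && uniq (z :: t') by [].
have off u : u \in z :: t' -> u != x by move=> ut'; apply: contraNneq xt => <-.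
set s2 := State _ _.
apply: (@runs_seq _ _ _ _ (60 * D + 300) _ _ _
  (@runs_flip_loop a b z t' (upR R x a (Some z)) s2 ab hw' ut _ _ hr1 _)).
- by rewrite zx.
- by move=> u uz; apply: upR_far; apply: off.
- by rewrite /s2; split; rsimp => //; rewrite f1.
- move=> s3 [f3 h3 hr3 [p [q [e17' e18 e19 [lp lq] pq]]]].
  (* At the end of the path [p] becomes present and [q] missing, hence one deletion and one
     insertion. *)
  set w := last z t' in e17' lp lq.
  have wt : w \in z :: t' by apply: mem_last.
  have wb : w \notin belast z t'.
    by move: ut; rewrite lastI rcons_uniq => /andP[].
  have wx := off _ wt; set Rc := fun u c => _ in hr3.
  have Rw c : Rc w c = R w c by rewrite /Rc (negbTE wb) upR_far.
  case wq : (R w q) lq => [v|//] _.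
  have pNq : p != q by apply/eqP => e; rewrite -e lp in wq.
  step; step; step.
  rewrite e17' e18 e19 (rep_marr w hr3) (rep_Some hr3 (c := q) (w := v)); last by rewrite Rw.
  apply: (@runs_seq _ _ _ _ (30 * D + 120) _ _ _
    (@runs_delete _ _ _ _ _ wf Rc _ w p v _ _ _ _ _)); rsimp => //; first by rewrite Rw.
  + move=> s4 [f4 hr4 h4]; step; step.
    rewrite (f4 17) // (f4 19) //; rsimp; rewrite e17' e19 (rep_marr w hr4).
    apply: (@runs_weaken _ _ (30 * #|blank (upR Rc w p (Some v) w)| + 60)).
    * apply: (@runs_insert _ _ _ _ _ wf (upR Rc w p (Some v)) _ w q) => //.
      by rewrite upRE eqxx /= eq_sym (negbTE pNq) Rw wq.
    * by move: (bD (blank (upR Rc w p (Some v) w))); budget.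
    move=> s5 [f5 hr5 h5]; split.
    * move=> r lt ne; have lt20 : r < 20 by apply: leq_trans lt _.
      rewrite f5 //; rsimp; rewrite !(upd_ge _ _ lt) // f4 //; rsimp.
      rewrite !(upd_ge _ _ lt) // f3 // /s2; rsimp.
      rewrite (upd_neq _ _ ne) !(upd_ge _ _ lt) // f1 //; rsimp.
      by rewrite !(upd_ge _ _ lt).
    * move=> c fc; rewrite h5 // h4 // h3 // h1 //.
    * apply: rep_ext hr5 => u c; rewrite !upRE /Rc /flip.
      have [uw|uw] := eqVneq u w => /=.
        rewrite uw (negbTE wb) (negbTE wx) [_ \in x :: _]inE wt orbT /=.
        rewrite upRE (negbTE wx) /= /swap.
        by case: pq lp wq => [[-> ->]|[-> ->]] lp wq;
          have [ca|_] := eqVneq c a; have [cb|_] := eqVneq c b;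
          rewrite ?lp ?wq //; move: ab; rewrite -ca -cb eqxx.
      have [ux|ux] := eqVneq u x => /=.
        have xb' : x \notin belast z t'.
          by apply/negP => xb'; case/negP: xt; rewrite lastI mem_rcons inE xb' orbT.
        rewrite ux (negbTE xb') mem_head upRE eqxx /= /swap.
        have [->|_] := eqVneq c a; first by rewrite (negbTE ab) xz.
        by have [->|_] := eqVneq c b; rewrite ?xz.
      rewrite [_ \in x :: _]inE (negbTE ux) /= lastI mem_rcons inE (negbTE uw) /=.
      by rewrite upRE (negbTE ux).
    * by rewrite f5 //; rsimp; rewrite f4.
  + by move: (bD (blank (Rc w))); budget.
- by budget.
Qed.
End FlipPath.
End Flip.

Section Rotate.
Variables (x y : T) (axy : adj x y) (a b : 'I_D).
Variable sn : seq (option 'I_D * 'I_D).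
Let sigma c := if c == b then a else c.

Definition rotate_cost R (l : seq 'I_D) : nat :=
  \sum_(c <- l) (if R x c is Some z then #|blank (R z)| else 0).+1.

(* The color [d] is missing at [x], but the row of [x] still holds its old
   entry [stale], which the next recoloring overwrites. *)
Lemma runs_rotate_loop l R d k stale s :
  rotatable adj R x y d (map sigma l) -> chain sn k l ->
  (forall k' c, (k', c) \in sn -> c \in l ->
     heap s (free + (sigma c).+1) = (index_code k').+1) ->
  rep L (upR R x d (Some stale)) (heap s) ->
  [/\ regs s 1 = vaddr L x, regs s 4 = free & regs s 5 = marr L x] ->
  [/\ regs s 11 = index_code k, regs s 13 = d.+1, regs s 15 = a.+1
    & regs s 16 = b.+1] ->
  runs rotate_loop s (300 * rotate_cost R (map sigma l) + 4) (fun s' =>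
    frame 6 s s' /\ exists R' d' stale',
      [/\ rep L (upR R' x d' (Some stale')) (heap s'), regs s' 13 = d'.+1,
        R' y =1 R y, R' y d' = None
        & forall v c, recolor R' x y None d' v c = rotate R x y d (map sigma l) v c]).
Proof.
elim: l R d k stale s => [|c l IHl] R d k stale s hR ch hpar hr [r1 r4 r5] [r11 r13 r15 r16].
  move: ch => /= ch; apply: (@runs_while _ _ _ 0 _ (fun=> False)) => //=.
  - by lia.
  - move=> _; split=> //; exists R, d, stale; split=> //.
    by case: hR => _ _ _ _.
  - by rewrite r11 ch.
move: ch => /= [kE [k' kc ch]].
have [_ [_ xd] _ _ [z [xz zd hl]]] := hR.
have [[hR' _ hoc [axz zy]] far] := rotatable_step adjC adjN hR xz.
have vR : valid adj R by case: hR.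
have zx : z != x by apply/eqP => e; rewrite e adjN in axz.
have zc : R z (sigma c) = Some x by have [_] := vR.1 _ _ _ xz.
have cd : sigma c != d by apply/eqP => e; rewrite -e xz in xd.
rewrite /rotate_cost /= big_cons xz -/(rotate_cost R _).
set B := #|blank (R z)|.
pose Q1 s1 := [/\ frame 6 s s1,
   rep L (upR (recolor R x z (Some (sigma c)) d) x (sigma c) (Some z)) (heap s1),
   forall e, free <= e -> heap s1 e = heap s e
  & [/\ regs s1 11 = index_code k', regs s1 13 = (sigma c).+1, regs s1 15 = a.+1
    & regs s1 16 = b.+1]].
apply: (@runs_while _ _ _ (60 * B + 240) _ Q1) => /=.
- by lia.
- by rewrite r11 kE.
- move=> _; rewrite /rotate_body.
  set rest := (Assign 17 (Read (Add (Reg 5) (Reg 11))) ;; _).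
  have hrest s1 : heap s1 = heap s -> (forall r, r != 11 -> regs s1 r = regs s r) ->
      regs s1 11 = (sigma c).+1 -> runs rest s1 (60 * B + 220) Q1.
    move=> eh er e11; rewrite /rest.
    have xzs : upR R x d (Some stale) x (sigma c) = Some z.
      by rewrite upRE (negbTE cd) andbF.
    step; step; step; step; step.
    rewrite eh e11 !er // r1 r5 r13 (rep_Some hr xzs) (rep_marr z hr).
    have bz : blank (upR R x d (Some stale) z) = blank (R z).
      by apply: eq_blank; apply: upR_far.
    apply: (@runs_seq _ _ _ _ (30 * B + 120) _ _ _
      (@runs_delete _ _ _ _ _ wf (upR R x d (Some stale)) _ z d x _ _ _ _ _));
      rsimp => //.
    + by rewrite upR_far.
    + move=> s2 [f2 hr2 h2].
      set R2 := upR (upR R x d (Some stale)) z d (Some x) in hr2.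
      have R2z : R2 z (sigma c) = Some x.
        by rewrite /R2 upRE eqxx (negbTE cd) upR_far.
      step; step.
      rewrite (f2 18) // (f2 11) //; rsimp; rewrite e11.
      apply: (@runs_seq _ _ _ _ 30 _ _ _
        (@runs_insert _ _ _ _ _ wf R2 _ z (sigma c) _ _ _ _)); rsimp => //.
      * by rewrite R2z.
      * move=> s3 [f3 hr3 h3].
        step; step; apply: runs_assign => //; rsimp.
        rewrite !f3 //; rsimp; rewrite !f2 //; rsimp; rewrite e11 !er // r4 r5 r13.
        split; rsimp.
        -- move=> r lt; have lt20 : r < 20 by apply: leq_trans lt _.
           rsimp; rewrite !(upd_ge _ _ lt) // f3 //; rsimp.
           rewrite !(upd_ge _ _ lt) // f2 //; rsimp.
           rewrite !(upd_ge _ _ lt) // er //.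
           by apply: contraTneq lt => ->.
        -- have R3x : upR R2 z (sigma c) None x d = Some stale.
             rewrite upR_far 1?eq_sym // /R2 upR_far 1?eq_sym //.
             by rewrite upRE !eqxx.
           apply: rep_ext (rep_set wf z hr3 R3x) => u e.
           rewrite /R2 !upRE /recolor -[Some e == _]/(e == sigma c).
           have [ux|ux] := eqVneq u x; rewrite /= ?andbF.
             have [ux'|_] := eqVneq u z; first by move: zx; rewrite -ux' ux eqxx.
             rewrite ux; have [ed|ed] := eqVneq e d => /=.
               by rewrite ed eq_sym (negbTE cd).
             by have [->|_] := eqVneq e (sigma c).
           have [uz|uz] //= := eqVneq u z; rewrite uz.
           have [ed|ed] := eqVneq e d => /=.
             by rewrite ed eq_sym (negbTE cd).
           by have [_|_] := eqVneq e (sigma c).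
        -- move=> e fe; rewrite upd_neq; last first.
             by have := row_low wf x (ltn_ord d); lia.
           by rewrite h3 // h2.
        -- have low := row_low wf x (ltn_ord d).
           rewrite upd_neq; last by lia.
           rewrite h3; last by lia.
           rewrite h2; last by lia.
           rewrite (hpar k' c) ?mem_head // subn1 !f3 //; rsimp.
           by rewrite !f2 //; rsimp; rewrite !er.
      * have : blank (R2 z) \subset blank (R z).
          apply/subsetP => e; rewrite !inE /R2 upRE eqxx /=.
          by case: (e == d) => //; rewrite upR_far.
        by move/subset_leq_card; rewrite -/B; budget.
    + by rewrite bz -/B; budget.
  step; rewrite r11 r16 kE [index_code _]/= code_eq.
  have [cb|cb] := eqVneq c b.
    step; apply: runs_weaken (hrest _ _ _ _) _ (fun s' h => h); rsimp => //.
    - by move=> r ne; rewrite upd_neq.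
    - by rewrite r15 /sigma cb eqxx.
    - by budget.
  step; apply: runs_weaken (hrest _ _ _ _) _ (fun s' h => h) => //.
    by rewrite r11 kE /sigma (negbTE cb).
  by budget.
move=> _ s1 [f1 hr1 h1 [e11 e13 e15 e16]].
have ul : uniq (sigma c :: map sigma l) by case: hR.
have dl e : e \in map sigma l -> e != d.
  by move=> el; apply: contraPneq (springs_in hl el) => ->.
have xl e : e \in map sigma l -> recolor R x z (Some (sigma c)) d x e = R x e.
  move=> el; rewrite /recolor eqxx (negbTE (dl _ el)) -[Some e == _]/(e == sigma c).
  by case: eqP => // ec; move: ul; rewrite /= -ec el.
(* The rows of the vertices ahead are untouched, so their search costs may be counted in the system
   before the rotation. *)
have hcost : rotate_cost (recolor R x z (Some (sigma c)) d) (map sigma l)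
    = rotate_cost R (map sigma l).
  rewrite /rotate_cost; apply: eq_big_seq => e el; rewrite xl //.
  case xe : (R x e) => [w|//]; have [wx wz] := far _ _ el xe.
  by rewrite (eq_blank (recolor_far R _ _ wx wz)).
have yx : y != x by apply/eqP => e; move: axy; rewrite e adjN.
apply: runs_weaken (IHl _ _ k' z s1 hR' ch _ hr1 _ _) _ _ => //.
- move=> k1 e ke el; rewrite h1 ?leq_addr // (hpar k1) //.
  by rewrite inE el orbT.
- by rewrite !f1.
- by rewrite hcost; budget.
move=> s2 [f2 [R' [d' [st' [hr2 e13' ey yd er]]]]]; split.
  exact: frame_trans f1 f2.
exists R', d', st'; split=> // e.
by rewrite ey recolor_far // eq_sym.
Qed.

Lemma runs_rotate_chain l R d k stale s :
  rotatable adj R x y d (map sigma l) -> chain sn k l ->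
  (forall k' c, (k', c) \in sn -> c \in l ->
     heap s (free + (sigma c).+1) = (index_code k').+1) ->
  rep L (upR R x d (Some stale)) (heap s) ->
  [/\ regs s 1 = vaddr L x, regs s 2 = vaddr L y, regs s 4 = free
    & regs s 5 = marr L x] ->
  [/\ regs s 11 = index_code k, regs s 13 = d.+1, regs s 15 = a.+1
    & regs s 16 = b.+1] ->
  runs rotate_chain s
    (300 * rotate_cost R (map sigma l) + 30 * #|blank (R y)| + 200) (fun s' =>
    rep L (rotate R x y d (map sigma l)) (heap s')).
Proof.
move=> hR ch hpar hr [r1 r2 r4 r5] hregs.
have yx : y != x by apply/eqP => e; move: axy; rewrite e adjN.
have r145 : [/\ regs s 1 = vaddr L x, regs s 4 = free & regs s 5 = marr L x] by [].
apply: (@runs_seq _ _ _ _ (30 * #|blank (R y)| + 180) _ _ _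
  (runs_rotate_loop hR ch hpar hr r145 hregs)); last by budget.
move=> s1 [f1 [R' [d' [st [hr1 e13 ey yd er]]]]].
step; step; step; rewrite e13 !f1 // r1 r2 (rep_marr y hr1).
set R1 := upR R' x d' (Some st) in hr1.
have R1y : R1 y =1 R' y by apply: upR_far.
apply: (@runs_seq _ _ _ _ 20 _ _ _
  (@runs_delete _ _ _ _ _ wf R1 _ y d' x _ _ _ _ _)); rsimp => //.
- by rewrite R1y.
- move=> s2 [f2 hr2 h2]; apply: runs_write => //; rsimp.
  rewrite !f2 //; rsimp; rewrite e13 !f1 // r2 r5.
  have R2x : upR R1 y d' (Some x) x d' = Some st.
    by rewrite upR_far 1?eq_sym // /R1 upRE !eqxx.
  apply: rep_ext (rep_set wf y hr2 R2x) => u e; rewrite -er /R1 !upRE /recolor.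
  have [ux|ux] := eqVneq u x; rewrite /= ?andbF.
    have [ux'|_] := eqVneq u y; first by move: yx; rewrite -ux' ux eqxx.
    by rewrite ux; case: (e == d').
  by have [->|] := eqVneq u y.
- by rewrite (eq_blank R1y) (eq_blank ey); budget.
Qed.
End Rotate.
End Loops.

(** * The two complete programs *)

Definition choose_color (r : nat) : cmd :=
  If (Eqn (Reg 3) (Cst 0)) (Assign r (Read (Reg 5))) (Assign r (Reg 3)).

Definition find_type_cmd : cmd :=
  search ;;
  If (Eqn (Reg 14) (Cst 1))
    (Assign 0 (Cst 0) ;; Assign 1 (Cst 0))
    (choose_color 0 ;; Assign 1 (Reg 13)).

(** Giving register 15 the color of register 16 makes the relabeling of the rotation the identity.
    The deletion at [x], with [y] as provisional entry, produces the stale entry that the rotation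
    expects. *)
Definition prepare_free : cmd :=
  Assign 15 (Reg 13) ;;
  Assign 20 (Reg 5) ;;
  Assign 21 (Reg 13) ;;
  Assign 22 (Reg 2) ;;
  delete.

(** After the exchange [a] stands for [b] at [x]; the last write therefore copies the recorded
    parent of [b] to the entry of [a]. *)
Definition prepare_conflict : cmd :=
  choose_color 15 ;;
  flip_path ;;
  Assign 8 (Defs.Sub (Read (Add (Reg 4) (Reg 13))) (Cst 1)) ;;
  If (Eqn (Reg 8) (Cst 0)) (Assign 20 (Reg 2)) (Assign 20 (Read (Add (Reg 5) (Reg 8)))) ;;
  If (Eqn (Reg 20) (Reg 17)) Skip (Assign 11 (Reg 8)) ;;
  Write (Add (Reg 4) (Reg 15)) (Read (Add (Reg 4) (Reg 13))).

Definition extend_cmd : cmd :=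
  search ;;
  Assign 16 (Reg 13) ;;
  If (Eqn (Reg 14) (Cst 1)) prepare_free prepare_conflict ;;
  rotate_chain.

(** * The type of the path as a function of the neighborhood of [x] *)

Section PathType.
Variable D : nat.

Definition chosen (oc : option 'I_D) (mx : {set 'I_D}) : option 'I_D :=
  if oc is Some c then Some c else ohead (enum mx).

Definition path_type oc (mx : {set 'I_D}) (F : fan D) : {set 'I_D} :=
  match status mx F, chosen oc mx, todo F with
  | Some true, Some a, b :: _ => [set a; b]
  | _, _, _ => set0
  end.

Definition view_blank (view : {set option 'I_D * {set 'I_D}}) : {set 'I_D} :=
  [set c | ~~ [exists p in view, p.1 == Some c]].

(** At most one edge at [x] has a given color, so the pair picked is the only one. The palette of
    [y] is passed separately because the pairs with [None] do not tell which of them comes from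
    [y]. *)
Definition view_fan_blank (palY : {set 'I_D}) (view : {set option 'I_D * {set 'I_D}})
    (k : option 'I_D) : {set 'I_D} :=
  if k is Some c then
    if [pick p in view | p.1 == Some c] is Some p then ~: p.2 else set0
  else ~: palY.

Lemma fan_end_ext (mx : {set 'I_D}) mz mz' : mz =1 mz' -> fan_end mx mz = fan_end mx mz'.
Proof.
move=> e; rewrite /fan_end /fan_start e; apply: eq_iter => F.
by rewrite /fan_step; case: (todo F) => //; rewrite e.
Qed.

Section View.
Variables (T : finType) (adj : rel T) (pi : coloring T D) (x y : T).
Hypotheses (adjC : symmetric adj) (hp : partial_coloring adj pi).
Let R := system_of adj pi.

Lemma view_blankE : view_blank (nbr_view adj pi x) = blank (R x).
Proof.
apply/setP => c; rewrite !inE; case r : (R x c) => [z|] /=; last first.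
  apply/negP => /existsP[p /andP[/imsetP[z]]]; rewrite inE => a -> /= /eqP e.
  by have : R x c = Some z by [apply/(system_ofP _ _ _ hp)]; rewrite r.
move/(system_ofP _ _ _ hp): r => [a e]; apply/negbTE; rewrite negbK.
apply/existsP; exists (pi [set x; z], palette adj pi z); rewrite /= e eqxx andbT.
by rewrite -e; apply: imset_f; rewrite inE.
Qed.

Lemma view_fan_blankE : view_fan_blank (palette adj pi y) (nbr_view adj pi x)
  =1 fan_blank x y R.
Proof.
case=> [c|] /=; last exact: missingE.
case: pickP => [p /andP[/imsetP[z]]|no].
  rewrite inE => a -> /= /eqP e.
  have -> : R x c = Some z by apply/(system_ofP _ _ _ hp).
  exact: missingE.
case r : (R x c) => [z|//]; move/(system_ofP _ _ _ hp): r => [a e].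
have := no (pi [set x; z], palette adj pi z).
by rewrite /= e eqxx andbT -e imset_f // inE.
Qed.
End View.
End PathType.

(** * Correctness and running time of the complete programs *)

Section Main.
Variables (T : finType) (adj : rel T) (D : nat) (x y : T).
Hypotheses (adjC : symmetric adj) (adjN : irreflexive adj).
Hypotheses (D0 : 0 < D) (hD : max_deg adj <= D) (hw : weak adj D x y).
Variables (pi : coloring T D) (oc : option 'I_D) (L : layout T) (s0 : state).
Hypotheses (hp : partial_coloring adj pi) (hxy : [set x; y] \notin colored pi).
Hypothesis hoc : forall c', oc = Some c' -> c' \in missing adj pi x.
Hypothesis hin : input adj L pi x y oc s0.
Let R := system_of adj pi.
Let hR : valid adj R := valid_system_of adjC hp.
Let free := regs s0 4.
Local Notation mx := (blank (R x)).
Local Notation mz := (fan_blank x y R).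
Local Notation zv := (fan_vertex x y R).
Let F := fan_end mx mz.

Let axy : adj x y. Proof. by case: hw. Qed.
Let wf : wf_layout adj D L free. Proof. by case: hin. Qed.
Let hr : rep L R (heap s0). Proof. by case: hin => _ _ /(representsE L _ hp). Qed.

Let e0 : regs s0 0 = D. Proof. by case: hin => -[]. Qed.
Let e1 : regs s0 1 = vaddr L x. Proof. by case: hin => -[]. Qed.
Let e2 : regs s0 2 = vaddr L y. Proof. by case: hin => -[]. Qed.
Let e3 : regs s0 3 = ocolor_code oc. Proof. by case: hin => -[]. Qed.

Let xy c : R x c <> Some y.
Proof.
move=> /(system_ofP _ _ _ hp)[_ e]; case/negP: hxy.
by rewrite inE e.
Qed.

Let enough := weak_enough adjC hD hw hR xy.

(** Common to both cases: [R1] is the system after the exchange along [P], or the original one with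
    [P] empty. *)
Lemma finish R1 d l (P : seq T) : rotatable adj R1 x y d l ->
  (forall u v c, [set u; v] \notin path_edges x P ->
     R1 u c = Some v <-> R u c = Some v) ->
  (forall u v, joined R1 u v <-> joined R u v) ->
  (forall v, v != x -> v != last x P -> blank (R1 v) = blank (R v)) ->
  let pi' := coloring_of (rotate R1 x y d l) in
  [/\ partial_coloring adj pi', colored pi' = [set x; y] |: colored pi,
      forall f : {set T}, pi' f <> pi f -> x \in f \/ f \in path_edges x P
    & forall v : T, palette adj pi v <> palette adj pi' v ->
        v \in cnbr adj x \/ v = last x P].
Proof.
move=> hrot keep hj hb pi'; have [v1 far near hj'] := rotate_spec adjC adjN hrot.
have hp' : partial_coloring adj pi' by apply: partial_coloring_of.
have piE : pi = coloring_of R by rewrite coloring_ofK.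
split=> //.
- apply/setP => e; rewrite in_setU1; apply/(coloredP _ v1)/orP.
    move=> [u [v [c [-> r]]]].
    have /hj'[/hj[c' r']|->] : joined (rotate R1 x y d l) u v by exists c.
      by right; rewrite piE; apply/(coloredP _ hR); exists u, v, c'.
    by left.
  case=> [/eqP ->|].
    have /hj'[c r] : joined R1 x y \/ [set x; y] = [set x; y] by right.
    by exists x, y, c.
  rewrite piE => /(coloredP _ hR)[u [v [c [-> r]]]].
  have /hj'[c' r'] : joined R1 u v \/ [set u; v] = [set x; y].
    by left; apply/hj; exists c.
  by exists u, v, c'.
- move=> f ne; have [xf|xf] := boolP (x \in f); first by left.
  have [fP|fP] := boolP (f \in path_edges x P); first by right.
  have same c : pi' f = Some c <-> pi f = Some c.
    have p1 := coloring_ofP f c v1; have := coloring_ofP f c hR; rewrite -piE => p2.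
    split=> [/p1|/p2] [u [v [fE r]]]; [apply/p2|apply/p1]; exists u, v; split=> //.
      move: xf fP; rewrite fE !inE negb_or => /andP[xu xv] fP.
      by apply/keep => //; apply/near; rewrite // eq_sym.
    move: xf fP; rewrite fE !inE negb_or => /andP[xu xv] fP.
    by apply/near; rewrite 1?eq_sym //; apply/keep.
  case: ne; case p' : (pi' f) => [c|]; first by apply/esym/same.
  by case p : (pi f) => [c|//]; move/same: p; rewrite p'.
- move=> v ne; have [vl|vl] := eqVneq v (last x P); first by right.
  left; rewrite !inE; have [//|vx] := eqVneq v x; rewrite /=.
  apply/negPn/negP => av; apply: ne; apply: setC_inj.
  rewrite -[LHS]/(missing adj pi v) -[RHS]/(missing adj pi' v) !missingE.
  rewrite -(hb _ vx vl) -(eq_blank (far _ vx av)).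
  by apply: eq_blank => c; rewrite system_ofK.
Qed.

Lemma chosen_spec : exists a, [/\ chosen oc mx = Some a, R x a = None,
  forall c, oc = Some c -> a = c
  & (if regs s0 3 == 0 then heap s0 (marr L x) else regs s0 3) = a.+1].
Proof.
rewrite e3 /chosen; case ocE : oc => [c|] /=.
  exists c; split=> //; last by move=> c' [].
  by move: (hoc ocE); rewrite missingE inE => /eqP.
(* As [xy] is uncolored, the colors present at [x] inject into its at most [D - 1] other
   neighbors. *)
have : 0 < #|mx|.
  have h : D <= #|mx| + #|nbr adj x :\ y|.
    apply: (card_blank hR) => c w r; have [a _] := hR.1 _ _ _ r.
    by rewrite !inE a andbT; apply: contraPneq r => ->; apply: xy.
  have ye : y \in nbr adj x by rewrite inE.
  by have := deg_le hD x; rewrite /deg (cardsD1 y (nbr adj x)) ye; lia.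
move=> /card_gt0P[c cx]; case ex : (enum mx) => [|a t].
  by have := mem_enum mx c; rewrite ex cx.
exists a; split=> //.
  by have := mem_enum mx a; rewrite ex mem_head => /esym; rewrite inE => /eqP.
by have [_ _ [_ -> _]] := hr x; rewrite next_codeE later0 ex.
Qed.

Lemma runs_choose_color r s K (Q : state -> Prop) a : 9 < K ->
  frame 5 s0 s -> regs s 5 = marr L x -> heap s (marr L x) = heap s0 (marr L x) ->
  (if regs s0 3 == 0 then heap s0 (marr L x) else regs s0 3) = a ->
  Q (State (upd (regs s) r a) (heap s)) -> runs (choose_color r) s K Q.
Proof.
move=> hK f r5 hx ca hQ; apply: runs_if; rsimp; rewrite f //.
by move: ca; case: ifP => _ ca; apply: runs_assign => /=; try lia;
  rewrite ?r5 ?hx ?f // ca.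
Qed.

Lemma runs_find_type : runs find_type_cmd s0 (300 * D + 400) (fun s' =>
  outputs_type (path_type oc mx F) s' /\ rep L R (heap s')).
Proof.
apply: (@runs_seq _ _ _ _ 50 _ _ _ (runs_search wf enough hr e0 e1 e2 erefl));
  last by budget.
move=> s1 [fs _ [b [st e14]]].
have hr1 : rep L R (heap s1) := rep_free wf (fs_heap fs) hr.
rewrite /path_type -/F st; apply: runs_if; rsimp; rewrite e14.
case: b st e14 => st e14 /=; last first.
  step; apply: runs_assign => //; split=> //.
  by left.
have [a [-> xa _ ca]] := chosen_spec.
case te : (todo F) => [|c t]; first by move: st; rewrite /status te.
apply: (@runs_seq _ _ _ 20 10 _ (fun s2 => heap s2 = heap s1 /\
    regs s2 0 = a.+1 /\ regs s2 13 = c.+1)) => //.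
  apply: (runs_choose_color (a := a.+1)) => //.
  - exact: fs_frame fs.
  - exact: fs_row fs.
  - by apply: (fs_heap fs); have := row_low wf x (leq0n D); rewrite addn0.
  - by split=> //; split; rsimp => //; rewrite (fs_color fs) -/F te.
move=> s2 [h2 [r0 r13]]; apply: runs_assign => //; rsimp; rewrite r13; split.
  right; exists a, c; split; rsimp => //.
  apply/eqP => e; move: st; rewrite /status -/F te -e.
  by rewrite inE xa.
by rewrite h2.
Qed.

Lemma rotate_costE R1 (sigma : 'I_D -> 'I_D) l :
  (forall c, c \in l -> R1 x (sigma c) = R x c) ->
  (forall c, c \in l -> R x c <> None) ->
  (forall v, #|blank (R1 v)| = #|blank (R v)|) ->
  rotate_cost x R1 (map sigma l) <= chain_cost mz l.
Proof.
move=> h1 h2 h3; rewrite /chain_cost big_cons big_map /rotate_cost big_map.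
apply: leq_trans (leq_addl _ _); rewrite big_seq [X in _ <= X]big_seq.
apply: leq_sum => c cl; rewrite h1 //= .
by case: (R x c) (h2 _ cl) => // z _; rewrite h3.
Qed.

(** The constant is [300 * (4 * D + 1)] for the chain, plus [30 * D] for the list of [y], plus
    200. *)
Lemma rotation_budget R1 (sigma : 'I_D -> 'I_D) l :
  chain_cost mz l <= 3 * D + 1 + D ->
  (forall c, c \in l -> R1 x (sigma c) = R x c) ->
  (forall c, c \in l -> R x c <> None) ->
  (forall v, #|blank (R1 v)| = #|blank (R v)|) ->
  300 * rotate_cost x R1 (map sigma l) + 30 * #|blank (R1 y)| + 200
    <= 1230 * D + 500.
Proof.
move=> hc h1 h2 h3; have h := leq_trans (rotate_costE h1 h2 h3) hc.
have : #|blank (R1 y)| <= D by rewrite -[X in _ <= X](card_ord D) max_card.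
by move: h; clear; lia.
Qed.

Lemma runs_extend_free d t : todo F = d :: t -> status mx F = Some false ->
  exists l, rotatable adj R x y d l /\
    runs extend_cmd s0 (4000 * D) (fun s' => rep L (rotate R x y d l) (heap s')).
Proof.
move=> te st; have [inv _] := fan_end_done enough.
have [l [ch hrot hcost]] := rotate_free axy hR xy inv te st.
(* The identity, in the form of the relabeling used by the rotation. *)
pose sigma (c : 'I_D) := if c == d then d else c.
have sigmaK c : sigma c = c by rewrite /sigma; case: eqP.
have sl : map sigma l = l by rewrite (eq_map sigmaK) map_id.
have [_ [_ xd] _ _ _] := hrot.
have lx c : c \in l -> R x c <> None.
  by move=> /(chain_colors ch)/(fan_colors_x inv).
have budget_l := rotation_budget (sigma := sigma) hcost
  (fun c _ => congr1 (R x) (sigmaK c)) lx (fun v => erefl).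
exists l; split=> //.
apply: (@runs_seq _ _ _ _ (2500 * D) _ _ _ (runs_search wf enough hr e0 e1 e2 erefl));
  last by move: D0; budget.
move=> s1 [fs _ [b [st' e14]]].
have {e14 st'} e14 : regs s1 14 = 1 by move: st'; rewrite -/F st e14 => -[<-].
have hr1 : rep L R (heap s1) := rep_free wf (fs_heap fs) hr.
have f1 := fs_frame fs.
have e13 : regs s1 13 = d.+1 by rewrite (fs_color fs) -/F te.
have e5 := fs_row fs.
step; step; rewrite e14 /= /prepare_free.
do 8 step; rewrite e13 e5 f1 // e2.
have bD : #|blank (R x)| <= D by rewrite -[X in _ <= X](card_ord D) max_card.
apply: (@runs_seq _ _ _ _ (1230 * D + 500) _ _ _
  (@runs_delete _ _ _ _ _ wf R _ x d y _ xd _ _ _)); rsimp => //; last first.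
  by move: D0 bD; budget.
move=> s2 [f2 hr2 h2].
have hrot' : rotatable adj R x y d (map sigma l) by rewrite sl.
rewrite -sl; apply: runs_weaken (runs_rotate_chain wf adjC adjN axy hrot' ch _ hr2 _ _)
  budget_l (fun s' h => h).
- by move=> k' c kc _; rewrite -/(sigma c) sigmaK h2 ?leq_addr //; apply: (fs_seen fs).
- by rewrite !f2 //; rsimp; rewrite e5 !f1.
- by rewrite !f2 //; rsimp; rewrite (fs_cur fs) e13.
Qed.

Lemma runs_extend_conflict b t a s : todo F = b :: t -> status mx F = Some true ->
  chosen oc mx = Some a -> R x a = None -> walk R b a x s -> uniq (x :: s) ->
  exists l, rotatable adj (flip R (x :: s) a b) x y b l /\
    runs extend_cmd s0 (4000 * D + 70 * size s) (fun s' =>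
      rep L (rotate (flip R (x :: s) a b) x y b l) (heap s')).
Proof.
move=> te st ha xa hs us; have [inv _] := fan_end_done enough.
have [bx bs] : b \notin mx /\ b \in colors (seen F).
  by move: st; rewrite /status te; case: ifP => // _; case: ifP.
have xb : R x b <> None by move: bx; rewrite inE => /eqP.
have ab : a != b by apply/eqP => e; apply: xb; rewrite -e.
have [[k' b'] kb /= be] := mapP bs; subst b'.
have [k [l [kE ch hrot hcost]]] := rotate_conflict adjN axy hR xy inv xa te kb hs.
pose sigma (c : 'I_D) := if c == b then a else c.
have lx c : c \in l -> R x c <> None.
  by move=> /(chain_colors ch)/(fan_colors_x inv).
set R1 := flip R (x :: s) a b in hrot *.
have R1x c : R x c <> None -> R1 x (sigma c) = R x c.
  move=> rc; rewrite /sigma; have [->|/eqP cb] := eqVneq c b.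
    exact: flip_start_a.
  by rewrite /R1 flip_other // => ca; apply: rc; rewrite ca.
have budget_l := rotation_budget (R1 := R1) (sigma := sigma) hcost
  (fun c cl => R1x c (lx c cl)) lx (blank_flip R (x :: s) a b).
exists (map sigma l); split=> //.
apply: (@runs_seq _ _ _ _ (3300 * D + 70 * size s) _ _ _
    (runs_search wf enough hr e0 e1 e2 erefl));
  last by move: D0; budget.
move=> s1 [fs _ [st' [st2 e14]]].
have {e14 st' st2} e14 : regs s1 14 = 2 by move: st2; rewrite -/F st e14 => -[<-].
have hr1 : rep L R (heap s1) := rep_free wf (fs_heap fs) hr.
have f1 := fs_frame fs.
have e13 : regs s1 13 = b.+1 by rewrite (fs_color fs) -/F te.
have e5 := fs_row fs.
step; step; rewrite e14 /= /prepare_conflict.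
apply: runs_seqA.
have [a' [ha' _ _ ca]] := chosen_spec.
have {ha'} aE : a' = a by move: ha'; rewrite ha => -[].
set s2 := State _ _.
apply: (@runs_seq _ _ _ 20 (3200 * D + 70 * size s) _
  (fun s3 => s3 = State (upd (regs s2) 15 a.+1) (heap s1))); last by move: D0; budget.
  apply: (runs_choose_color (a := a.+1)) => //.
  - by rewrite /s2; frame_tac; apply: f1.
  - by apply: (fs_heap fs); have := row_low wf x (leq0n D); rewrite addn0.
  - by rewrite -aE.
move=> _ ->; apply: runs_seqA.
have [|z hz] := runs_flip_path wf adjN hR ab xa xb hs us
  (s := State (upd (regs s2) 15 a.+1) (heap s1)) hr1.
  by rewrite /s2; split; rsimp; rewrite ?e5 ?e13 ?(f1 0).
apply: (@runs_seq _ _ _ _ (2500 * D) _ _ _ hz); last by move: D0; budget.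
move=> s3 [f3 h3 hr3 e17].
have r3 r : r < 15 -> r != 8 -> regs s3 r = regs s1 r.
  move=> lt ne; rewrite f3 //; last by apply: leq_trans lt _.
  by rewrite /s2; rsimp; rewrite !(upd_ge _ _ lt).
have par c kc : (kc, c) \in seen F -> heap s3 (free + c.+1) = (index_code kc).+1.
  by move=> h; rewrite h3 ?leq_addr //; apply: (fs_seen fs).
apply: runs_seqA; step.
rewrite !r3 // e13 f1 // -/free (par _ _ kb) subn1 /=.
apply: runs_seqA; set s4 := State _ _.
apply: (@runs_seq _ _ _ 20 (2400 * D) _
  (fun s5 => s5 = State (upd (regs s4) 20 (vaddr L (zv k'))) (heap s3))); last by move: D0; budget.
  apply: runs_if; rewrite /s4; rsimp; case kE' : k' => [c|] /=.
    apply: runs_assign => //; rsimp; rewrite r3 // e5.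
    have kb' : (Some c, b) \in seen F by rewrite -kE'.
    have [bm ks _] := fan_seen inv kb'; have zb := fan_blank_None bm.
    have cs : c \in colors (seen F).
      have := mem_take ks; rewrite inE /= mem_map //.
      by move=> ? ? [].
    have rc := fan_vertex_Some inv cs.
    (* The edge of color [b] at [x] cannot end at a vertex missing [b]; so the entry read here is
       neither exchanged nor stale. *)
    have cb : c != b.
      apply/eqP => e; have [_ zx] := hR.1 _ _ _ rc.
      by move: zb; rewrite -e zx.
    have rc' : upR R1 x b (Some z) x c = Some (zv (Some c)).
      rewrite upRE (negbTE cb) andbF -rc -R1x ?rc //.
      by rewrite /sigma (negbTE cb).
    by rewrite (rep_Some hr3 rc').
  by apply: runs_assign => //; rsimp; rewrite r3 // f1 // e2.
move=> _ ->; apply: runs_seqA.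
set s5 := State _ _.
have s5r r : r < 15 -> r != 8 -> regs s5 r = regs s1 r.
  move=> lt ne; rewrite /s5 /s4; rsimp.
  by rewrite (upd_ge _ _ lt) // upd_neq // r3.
apply: (@runs_seq _ _ _ 20 (2300 * D) _
  (fun s6 => heap s6 = heap s3 /\
     forall r, r < 17 -> regs s6 r = upd (regs s5) 11 (index_code k) r));
  last by move: D0; budget.
  apply: runs_if; rewrite {1}/s5 /s4; rsimp; rewrite e17 kE.
  have [lk|lk] := eqVneq (last x s) (zv k').
    rewrite lk eqxx; apply: runs_skip => //; split=> // r _.
    rewrite updE; have [->|//] := eqVneq r 11.
    by rewrite s5r // (fs_cur fs).
  case: ifP => [/eqP e|_].
    by move: lk; rewrite (vaddr_inj wf e) eqxx.
  apply: runs_assign => //; split=> // r _; rsimp.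
move=> s6 [h6 r6]; step.
have s6r r : r < 15 -> r != 8 -> r != 11 -> regs s6 r = regs s1 r.
  move=> lt ne ne'; rewrite r6; last by apply: leq_trans lt _.
  by rewrite upd_neq // s5r.
have e15 : regs s6 15 = a.+1.
  by rewrite r6 // upd_neq // /s5 /s4; rsimp; rewrite f3.
have e16 : regs s6 16 = b.+1.
  by rewrite r6 // upd_neq // /s5 /s4; rsimp; rewrite f3 // /s2; rsimp.
rewrite s6r // e15 s6r // e13 f1 // h6 -/free.
set s7 := State _ _.
apply: runs_weaken (runs_rotate_chain wf adjC adjN axy (s := s7) (a := a) (b := b) hrot ch _ _ _ _)
  _ (fun s' h => h).
(* The entry of [a] was overwritten for the relabeled [b]; no chain color is [a], which is missing
   at [x], so no other parent is lost. *)
- move=> k1 c kc cl; rewrite /s7; rsimp; have [cb|cb] := eqVneq c b.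
    by rewrite upd_eq (par _ _ kb); subst c; rewrite (seen_inj inv kc kb).
  rewrite upd_neq ?(par _ _ kc) // eqn_add2l code_eq.
  by apply: contraPneq (lx _ cl) => ->.
- by apply: (rep_free wf _ hr3) => c cf; rewrite /s7; rsimp; rewrite upd_neq //; lia.
- by rewrite /s7; rsimp; rewrite !s6r // e5 !f1.
- by rewrite /s7; rsimp; rewrite (r6 11) // upd_eq (s6r 13).
- by apply: leq_trans budget_l _; move: D0; budget.
Qed.

End Main.

Theorem theorem9 :
  exists (extend find_type : cmd) (C : nat),
  forall (T : finType) (adj : rel T) (D : nat) (x y : T),
    symmetric adj -> irreflexive adj ->
    0 < D -> max_deg adj <= D -> weak adj D x y ->
  exists tau : option 'I_D -> {set 'I_D} -> {set option 'I_D * {set 'I_D}} ->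
               {set 'I_D},
  forall (pi : coloring T D) (oc : option 'I_D) (L : layout T) (s : state),
    partial_coloring adj pi ->
    [set x; y] \notin colored pi ->
    (forall c' : 'I_D, oc = Some c' -> c' \in missing adj pi x) ->
    input adj L pi x y oc s ->
  exists (pi' : coloring T D) (P : seq T) (t : {set 'I_D}),
    (* correctness and running time; [size P] is the number of edges of P *)
    [/\ partial_coloring adj pi',
        colored pi' = [set x; y] |: colored pi,
        max_alt_path_or_empty adj pi x P t
      & exists (k : nat) (s' : state),
          [/\ exec extend s k s', k <= C * (D + size P)
            & represents adj L pi' (heap s')]] /\
    [/\ (* V1 *)
        P <> [::] ->
          exists c' : 'I_D, [/\ c' \in missing adj pi x, c' \in t
            & forall c : 'I_D, oc = Some c -> c' = c],
        (* V2 *)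
        forall f : {set T}, pi' f <> pi f ->
          x \in f \/ f \in path_edges x P,
        (* V3 *)
        forall v : T, palette adj pi v <> palette adj pi' v ->
          v \in cnbr adj x \/ v = last x P,
        (* V4 *)
        exists (k : nat) (s' : state),
          [/\ exec find_type s k s', k <= C * D, outputs_type t s'
            & represents adj L pi (heap s')]
      & (* V5 *)
        t = tau oc (palette adj pi y) (nbr_view adj pi x)].
Proof.
(* The two bounds are [4000 * D + 70 * size P] and [300 * D + 400]; additive constants are absorbed
   because [0 < D]. *)
exists extend_cmd, find_type_cmd, 4000 => T adj D x y adjC adjN D0 hD hw.
exists (fun oc palY view => path_type oc (view_blank view)
  (fan_end (view_blank view) (view_fan_blank palY view))).
move=> pi oc L s hp hxy hoc hin.
set R := system_of adj pi; have hR : valid adj R := valid_system_of adjC hp.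
set F := fan_end (blank (R x)) (fan_blank x y R).
have vE : path_type oc (view_blank (nbr_view adj pi x))
    (fan_end (view_blank (nbr_view adj pi x))
       (view_fan_blank (palette adj pi y) (nbr_view adj pi x)))
    = path_type oc (blank (R x)) F.
  by rewrite view_blankE // (fan_end_ext _ (view_fan_blankE x y hp)).
rewrite vE.
have xy c : R x c <> Some y.
  by move=> /(system_ofP _ _ _ hp)[_ e]; case/negP: hxy; rewrite inE e.
have [kt [st [et lt [ot rt]]]] := runs_find_type adjC D0 hD hw hp hxy hoc hin.
have V4 : exists k s', [/\ exec find_type_cmd s k s', k <= 4000 * D,
    outputs_type (path_type oc (blank (R x)) F) s' & represents adj L pi (heap s')].
  exists kt, st; split=> //; first by move: lt D0; clear; lia.
  by apply/representsE.
have [inv stF] := fan_end_done (weak_enough adjC hD hw hR xy).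
have output R' s' : valid adj R' -> rep L R' (heap s') ->
    represents adj L (coloring_of R') (heap s').
  move=> v' r'; apply/representsE; first exact: partial_coloring_of.
  by apply: rep_ext r' => v c; rewrite system_ofK.
case te : (todo F) => [|d t]; first by move: stF; rewrite /status -/F te.
case st' : (status (blank (R x)) F) stF => [[]|//] _; last first.
  have [l [hrot [k [s' [ex le r']]]]] :=
    runs_extend_free adjC adjN D0 hD hw hp hxy hin te st'.
  have [h1 h2 h3 h4] := finish (P := [::]) adjC adjN hp hrot
    (fun _ _ _ _ => iff_refl _) (fun _ _ => iff_refl _) (fun _ _ _ => erefl).
  have [v' _ _ _] := rotate_spec adjC adjN hrot.
  exists (coloring_of (rotate R x y d l)), [::], set0.
  rewrite /path_type st' in V4 *; split; last by split.
  split=> //; first by left.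
  by exists k, s'; split; [|rewrite addn0|apply: output].
have [a [ha xa hac _]] := chosen_spec adjC D0 hD hw hp hxy hoc hin.
have bx : d \notin blank (R x) by move: st'; rewrite /status te; case: ifP.
have xb : R x d <> None by move: bx; rewrite inE => /eqP.
have ad : a != d by apply/eqP => e; apply: xb; rewrite -e.
have [P [hP uP]] := walk_exists adjN hR ad xa.
have [l [hrot [k [s' [ex le r']]]]] :=
  runs_extend_conflict adjC adjN D0 hD hw hp hxy hoc hin te st' ha xa hP uP.
have [h1 h2 h3 h4] := finish (P := P) adjC adjN hp hrot
  (fun u v c ne => flip_keep hR xa hP c ne) (flip_joined R x a d P)
  (flip_blank hR hP).
have [v' _ _ _] := rotate_spec adjC adjN hrot.
have pt : path_type oc (blank (R x)) F = [set a; d] by rewrite /path_type st' ha te.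
have Pn : P <> [::] by move=> e; move: hP; rewrite e.
exists (coloring_of (rotate (flip R (x :: P) a d) x y d l)), P, [set a; d].
rewrite pt in V4 *; split; last first.
  split=> // _; exists a; split=> //; last by rewrite !inE eqxx.
  by rewrite missingE inE xa.
split=> //.
  right; split=> //; exists a, d; split=> //.
  exact: (walk_max_alt_path adjC hp xa xb hP uP).
exists k, s'; split=> //; last exact: output.
by move: le; clear; lia.
Qed.
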